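(* Let $0<q<1$ and let $G/P_S$ be an irreducible flag manifold. Let $\mathcal{B}\cong\mathbb{C}_q[G/P_S]$ be the $*$-algebra with $(\mathsf{f}^i\mathsf{v}^j)^*=\mathsf{f}^j\mathsf{v}^i$, let $\Gamma_{\mathrm d}=\Gamma_\partial\oplus\Gamma_{\overline\partial}$ be the direct sum of the two Heckenberger–Kolb first order differential calculi over $\mathcal{B}$, and let $(\Gamma^\wedge_{\mathrm d,\mathrm u},\mathrm d)$ be its universal differential calculus. Then $(\Gamma^\wedge_{\mathrm d,\mathrm u},\mathrm d)$ is a differential $*$-calculus over $\mathcal{B}$; that is, the $*$-structure of $\mathcal{B}$ extends to a (conjugate-linear) involution $*$ of $\Gamma^\wedge_{\mathrm d,\mathrm u}$ such that $(\mathrm d\omega)^*=\mathrm d(\omega^* )$ for all $\omega$ and $(\omega\wedge\chi)^*=(-1)^{kl}\chi^*\wedge\omega^*$ for all $\omega$ of degree $k$ and $\chi$ of degree $l$.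
   Context: **Quantum group.** $\mathfrak g$ is a complex simple Lie algebra of rank $r$ with Cartan subalgebra $\mathfrak h$, simple roots $\Pi=\{\alpha_1,\dots,\alpha_r\}$, fundamental weights $\omega_i$, $(\cdot,\cdot)$ the non-degenerate symmetric bilinear form on $\mathfrak h^*$ induced by the Killing form, $\rho$ the half-sum of positive roots; $0<q<1$. $U_q(\mathfrak g)$ is the Hopf $*$-algebra with generators $K_i^{\pm1},E_i,F_i$ and the usual relations ($K_iE_jK_i^{-1}=q^{(\alpha_i,\alpha_j)}E_j$, $K_iF_jK_i^{-1}=q^{-(\alpha_i,\alpha_j)}F_j$, $[E_i,F_j]=\delta_{ij}(K_i-K_i^{-1})/(q_i-q_i^{-1})$ with $q_i=q^{(\alpha_i,\alpha_i)/2}$, quantum Serre relations), $\Delta(K_i)=K_i\otimes K_i$, $\Delta(E_i)=E_i\otimes K_i+1\otimes E_i$, $\Delta(F_i)=F_i\otimes1+K_i^{-1}\otimes F_i$, $S(K_i)=K_i^{-1}$, $S(E_i)=-E_iK_i^{-1}$, $S(F_i)=-K_iF_i$, $K_i^*=K_i$, $E_i^*=F_iK_i$, $F_i^*=K_i^{-1}E_i$. Modules are finite-dimensional of type 1; $V(\mu)$ is the simple module of highest weight $\mu$; the dual is a module by $(Xf)(v)=f(S(X)v)$. The braiding $\hat R_{V,W}:V\otimes W\to W\otimes V$ is the braiding of the category of such modules determined by $\hat R_{V,W}(v_{\rm hw}\otimes w_{\rm lw})=q^{(\mathrm{wt}\,v_{\rm hw},\mathrm{wt}\,w_{\rm lw})}w_{\rm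 lw}\otimes v_{\rm hw}$ ($v_{\rm hw}$ highest weight vector of $V$, $w_{\rm lw}$ lowest weight vector of $W$, for simple $V,W$). Components with respect to bases: $\hat R_{V,W}(v_i\otimes w_j)=\sum_{k,l}(\hat R_{V,W})^{kl}_{ij}w_k\otimes v_l$, and similarly for inverses, $\hat R_{V,W}^{-1}(w_i\otimes v_j)=\sum_{k,l}(\hat R_{V,W}^{-1})^{kl}_{ij}v_k\otimes w_l$. **Irreducible flag manifolds.** $S=\Pi\setminus\{\alpha_s\}$ where $\alpha_s$ has multiplicity $1$ in the highest root of $\mathfrak g$; $P_S$ is the standard parabolic subgroup with Levi factor determined by $S$. Put $V=V(\omega_s)$, $N=\dim V$, and fix a weight basis $\{v_i\}_{i=1}^N$ of $V$, orthonormal for an inner product (conjugate-linear in the first variable) with $(Xv,w)=(v,X^*w)$, with $v_N$ a highest weight vector; $\{f_i\}$ is the dual basis of $V^*$. **The algebras.** $\mathcal A_+$: generators $\mathsf f^1,\dots,\mathsf f^N$, relations $\mathsf f^i\mathsf f^j=q^{-(\omega_s,\omega_s)}\sum_{k,l}(\hat R_{V,V})^{ij}_{kl}\mathsf f^k\mathsf f^l$. $\mathcal A_-$: generators $\mathsf v^1,\dots,\mathsf v^N$, relations $\mathsf v^i\mathsf v^j=q^{-(\omega_s,\omega_s)}\sum_{k,l}(\hat R_{V^*,V^*})^{ij}_{kl}\mathsf v^k\mathsf v^l$. $\mathcal A_{\mathbb C}=\mathcal A_+\otimes\mathcal A_-$ with exchange relations $\mathsf v^i\mathsf f^j=q^{(\omega_s,\omega_s)}\sum_{k,l}(\hat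 R_{V,V^*})^{ij}_{kl}\mathsf f^k\mathsf v^l$. The element $\mathsf c=\sum_i\mathsf v^i\mathsf f^i$ is central; $\mathcal A=\mathcal A_{\mathbb C}/\langle\mathsf c-1\rangle$, graded by $\deg\mathsf f^i=-1$, $\deg\mathsf v^i=1$; $\mathcal B=\mathcal A^0$ is the degree zero part (isomorphic to $\mathbb C_q[G/P_S]$), generated by the $\mathsf f^i\mathsf v^j$. $\mathcal A$ is a $*$-algebra by $(\mathsf f^i)^*=\mathsf v^i$, and $\mathcal B$ is a $*$-subalgebra. **FODCs.** A first order differential calculus (FODC) over an algebra $\mathcal R$ is an $\mathcal R$-bimodule $\Gamma$ with a linear map $\mathrm d:\mathcal R\to\Gamma$ satisfying the Leibniz rule and $\Gamma=\mathrm{span}\{a\,\mathrm d(b)\,c\}$. The FODC induced on a subalgebra $\mathcal R'$ is $\mathrm{span}\{a\,\mathrm d(b):a,b\in\mathcal R'\}$ with the restricted $\mathrm d$. The direct sum of FODCs $(\Gamma_i,\mathrm d_i)$ is $\mathcal R\cdot\mathrm d(\mathcal R)\subset\bigoplus_i\Gamma_i$ with $\mathrm d=\bigoplus_i\mathrm d_i$. *$\Gamma_\partial$.* Let $\hat P_V=\hat R_{V,V}-q^{(\omega_s,\omega_s)}\mathrm{id}$, $\hat Q_V=\hat R_{V,V}+q^{(\omega_s,\omega_s)-(\alpha_s,\alpha_s)}\mathrm{id}$. $\Gamma_+$ is the left $\mathcal A_+$-module generated by $\mathrm d\mathsf f^1,\dots,\mathrm d\mathsf f^N$ with relations $\sum_{i,j}(\hat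 P_V\hat Q_V)^{kl}_{ij}\mathsf f^i\mathrm d\mathsf f^j=0$, a bimodule via $(\mathrm d\mathsf f^i)\mathsf f^j=q^{(\alpha_s,\alpha_s)-(\omega_s,\omega_s)}\sum_{k,l}(\hat R_{V,V})^{ij}_{kl}\mathsf f^k\mathrm d\mathsf f^l$. $\Gamma_{+,\mathbb C}=\mathcal A_{\mathbb C}\otimes_{\mathcal A_+}\Gamma_+$ is an $\mathcal A_{\mathbb C}$-bimodule via $(\mathrm d\mathsf f^i)\mathsf v^j=q^{-(\omega_s,\omega_s)}\sum_{k,l}(\hat R^{-1}_{V,V^*})^{ij}_{kl}\mathsf v^k\mathrm d\mathsf f^l$, with differential $\partial(\mathsf f^i)=\mathrm d\mathsf f^i$, $\partial(\mathsf v^i)=0$. $\Lambda_+$ is the sub-bimodule generated by $\partial(\mathsf c)$, $(\mathsf c-1)\Gamma_{+,\mathbb C}$, $\Gamma_{+,\mathbb C}(\mathsf c-1)$. $(\Gamma_\partial,\partial)$ is the FODC over $\mathcal B$ induced by the FODC $\Gamma_{+,\mathbb C}/\Lambda_+$ over $\mathcal A$. *$\Gamma_{\overline\partial}$.* Let $\hat P_{V^*}=\hat R_{V^*,V^*}-q^{(\omega_s,\omega_s)}\mathrm{id}$, $\hat Q_{V^*}=\hat R_{V^*,V^*}+q^{(\omega_s,\omega_s)-(\alpha_s,\alpha_s)}\mathrm{id}$. $\Gamma_-$ is the left $\mathcal A_-$-module generated by $\mathrm d\mathsf v^1,\dots,\mathrm d\mathsf v^N$ with relations $\sum_{i,j}(\hat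 P_{V^*}\hat Q_{V^*})^{kl}_{ij}\mathsf v^i\mathrm d\mathsf v^j=0$, a bimodule via $(\mathrm d\mathsf v^i)\mathsf v^j=q^{(\omega_s,\omega_s)-(\alpha_s,\alpha_s)}\sum_{k,l}(\hat R^{-1}_{V^*,V^*})^{ij}_{kl}\mathsf v^k\mathrm d\mathsf v^l$. $\Gamma_{-,\mathbb C}=\mathcal A_{\mathbb C}\otimes_{\mathcal A_-}\Gamma_-$ is an $\mathcal A_{\mathbb C}$-bimodule via $(\mathrm d\mathsf v^i)\mathsf f^j=q^{(\omega_s,\omega_s)}\sum_{k,l}(\hat R_{V,V^*})^{ij}_{kl}\mathsf f^k\mathrm d\mathsf v^l$, with differential $\overline\partial(\mathsf f^i)=0$, $\overline\partial(\mathsf v^i)=\mathrm d\mathsf v^i$. $\Lambda_-$ is the sub-bimodule generated by $\overline\partial(\mathsf c)$, $(\mathsf c-1)\Gamma_{-,\mathbb C}$, $\Gamma_{-,\mathbb C}(\mathsf c-1)$. $(\Gamma_{\overline\partial},\overline\partial)$ is the FODC over $\mathcal B$ induced by the FODC $\Gamma_{-,\mathbb C}/\Lambda_-$ over $\mathcal A$. **Differential calculi.** A differential calculus over $\mathcal B$ is a differential graded algebra $(\Gamma^\wedge=\bigoplus_k\Gamma^{\wedge k},\mathrm d)$ with $\Gamma^{\wedge0}=\mathcal B$, generated by $\mathcal B$ and $\mathrm d\mathcal B$. The universal differential calculus of a FODC $\Gamma$ is the one with degree one part $\Gamma$ such that every differential calculus with degree one part $\Gamma$ is a quotient of it. *)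

(* Defs.v *)
From HB Require Import structures.
From mathcomp Require Import all_boot all_order all_algebra.
From mathcomp.real_closed Require Import complex.
From mathcomp Require Import reals exp.

Set Implicit Arguments.
Unset Strict Implicit.
Unset Printing Implicit Defensive.

Import Order.TTheory GRing.Theory Num.Theory.
Local Open Scope ring_scope.

(** * Complex simple Lie algebras *)

Record simpleLie (R : realType) := SimpleLie {
  lie_sort :> vectType R[i];
  lie_br : lie_sort -> lie_sort -> lie_sort;
  lie_br_linearl : forall c x y z,
    lie_br (c *: x + y) z = c *: lie_br x z + lie_br y z;
  lie_br_linearr : forall c x y z,
    lie_br x (c *: y + z) = c *: lie_br x y + lie_br x z;
  lie_br_alt : forall x, lie_br x x = 0;
  lie_jacobi : forall x y z,
    lie_br x (lie_br y z) + lie_br y (lie_br z x) + lie_br z (lie_br x y) = 0;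
  lie_nonabelian : exists x y, lie_br x y != 0;
  lie_simple : forall I : {vspace lie_sort},
    (forall x y, y \in I -> lie_br x y \in I) -> I = 0%VS \/ I = fullv }.

Section Killing.
Variables (R : realType) (g : simpleLie R).
Local Notation C := R[i].

Definition ad (x : g) : 'End(g) := linfun (lie_br x).

Definition killing (x y : g) : C :=
  \tr (passmx.mxof (vbasis {:g}) (vbasis {:g}) (ad x \o ad y)%VF).

Variable H : {vspace g}.

Definition hdual : vectType C := 'Hom(subvs_of H, C^o).

Definition flat : 'Hom(subvs_of H, hdual) :=
  linfun (fun x => linfun (fun y => killing (vsval x) (vsval y) : C^o)).

Definition sharp : 'Hom(hdual, subvs_of H) := (flat^-1)%VF.

(* the form on the dual of H transported from the Killing form, i.e.
   (phi, psi) = kappa (t_phi, t_psi) with kappa (t_phi, h) = phi h *)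
Definition hform (phi psi : hdual) : C :=
  killing (vsval (sharp phi)) (vsval (sharp psi)).

Definition is_root (phi : hdual) : Prop :=
  phi <> 0 /\
  exists2 x : g, x != 0 & forall h, lie_br (vsval h) x = phi h *: x.

End Killing.

(* [cartan_maxabelian] and [cartan_diag] : a Cartan subalgebra is a maximal
   abelian subalgebra acting diagonalizably.  [killing_nondeg] records the
   non-degeneracy of the induced form, which makes [sharp] the inverse of
   [flat]. *)
Record cartanData (R : realType) (g : simpleLie R) := CartanData {
  cartan : {vspace g};
  cartan_maxabelian : forall x,
    (x \in cartan) <-> (forall y, y \in cartan -> lie_br x y = 0);
  cartan_diag : forall h, h \in cartan ->
    exists b : (\dim {:g}).-tuple g, basis_of fullv b /\
      forall i, exists a : R[i], lie_br h b`_i = a *: b`_i;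
  killing_nondeg : forall x, x \in cartan ->
    (forall y, y \in cartan -> killing x y = 0) -> x = 0;
  rank : nat;
  sroot : rank.-tuple (hdual cartan);
  sroot_basis : basis_of fullv sroot;
  sroot_root : forall i, is_root (tnth sroot i);
  sroot_sign : forall phi, is_root phi -> exists m : 'I_rank -> nat,
    phi = \sum_i tnth sroot i *+ m i \/ phi = - \sum_i tnth sroot i *+ m i;
  fweight : rank.-tuple (hdual cartan);
  fweightE : forall i j,
    2 * hform (tnth fweight i) (tnth sroot j)
    = (i == j)%:R * hform (tnth sroot j) (tnth sroot j) }.

Section RootData.
Variables (R : realType) (g : simpleLie R) (t : cartanData g).

Definition alpha (i : 'I_(rank t)) : hdual (cartan t) := tnth (sroot t) i.
Definition omega (i : 'I_(rank t)) : hdual (cartan t) := tnth (fweight t) i.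

Definition integral_weight (mu : hdual (cartan t)) : Prop :=
  exists m : 'I_(rank t) -> int, mu = \sum_i omega i *~ m i.

(* alpha_s has multiplicity one in the highest root, i.e. G / P_S with
   S = Pi \ {alpha_s} is an irreducible flag manifold *)
Definition irreducible_flag (s : 'I_(rank t)) : Prop :=
  exists n : 'I_(rank t) -> nat,
  [/\ is_root (\sum_i alpha i *+ n i),
      (forall m : 'I_(rank t) -> nat, is_root (\sum_i alpha i *+ m i) ->
         forall i, (m i <= n i)%N)
    & n s = 1%N].

End RootData.

(** * Tensor products of finite-dimensional vector spaces *)

Section Tensor.
Variable R : realType.
Local Notation C := R[i].

(* U (x) W is the space of coordinate matrices w.r.t. the library's chosen
   bases of U and W. *)
Definition tens (U W : vectType C) : vectType C :=
  'M[C]_(\dim {:U}, \dim {:W}).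

Definition tpure (U W : vectType C) (u : U) (w : W) : tens U W :=
  \matrix_(i, j) (coord (vbasis {:U}) i u * coord (vbasis {:W}) j w).

(* the linear map out of U (x) W induced by a bilinear map b *)
Definition tlift (U W X : vectType C) (b : U -> W -> X) : 'Hom(tens U W, X) :=
  linfun (fun m : tens U W =>
    \sum_i \sum_j (m : 'M_(_, _)) i j *: b (vbasis {:U})`_i (vbasis {:W})`_j).

Definition tmap (U W U' W' : vectType C)
    (f : 'Hom(U, U')) (h : 'Hom(W, W')) : 'Hom(tens U W, tens U' W') :=
  tlift (fun u w => tpure (f u) (h w)).

Definition tassoc (U W X : vectType C) :
    'Hom(tens (tens U W) X, tens U (tens W X)) :=
  tlift (fun m x => tlift (fun u w => tpure u (tpure w x)) m).

(* the coefficient of u_k (x) w_l *)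
Definition tcoord (U W : vectType C) (a b : nat) (bU : a.-tuple U)
    (bW : b.-tuple W) (k : 'I_a) (l : 'I_b) : 'Hom(tens U W, C^o) :=
  tlift (fun u w => coord bU k u * coord bW l w : C^o).

(* T^{kl}_{ij}, where T (u_i (x) w_j) = sum_{k,l} T^{kl}_{ij} u'_k (x) w'_l *)
Definition components (U W U' W' : vectType C) (a b a' b' : nat)
    (bU : a.-tuple U) (bW : b.-tuple W) (bU' : a'.-tuple U') (bW' : b'.-tuple W')
    (T : 'Hom(tens U W, tens U' W')) (k : 'I_a') (l : 'I_b') (i : 'I_a)
    (j : 'I_b) : C :=
  tcoord bU' bW' k l (T (tpure (tnth bU i) (tnth bW j))).

End Tensor.

(** * Modules over the quantized enveloping algebra *)

Section QuantumGroup.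
Variables (R : realType) (g : simpleLie R) (t : cartanData g) (q : R).
Local Notation C := R[i].
Local Notation "( x , y )f" := (hform x y) (at level 0, format "( x , y )f").

(* q^z; only used for exponents z that are rational numbers, the values of the
   form on integral weights and halves of these *)
Definition qpow (z : C) : C := (q `^ complex.Re z)%:C%C.

(* A space with operators for the generators K_i, K_i^-1, E_i, F_i; it is a
   module when the defining relations hold, see [Uq_relations]. *)
Record preModule := PreModule {
  pm_sort :> vectType C;
  opK : 'I_(rank t) -> 'End(pm_sort);
  opK' : 'I_(rank t) -> 'End(pm_sort);
  opE : 'I_(rank t) -> 'End(pm_sort);
  opF : 'I_(rank t) -> 'End(pm_sort) }.

Definition qnum (x : C) (m : nat) : C := (x ^+ m - x ^- m) / (x - x^-1).
Definition qfact (x : C) (m : nat) : C := \prod_(1 <= k < m.+1) qnum x k.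
Definition qbin (x : C) (m k : nat) : C :=
  qfact x m / (qfact x k * qfact x (m - k)).

Definition q_ (i : 'I_(rank t)) : C := qpow ((alpha i, alpha i)f / 2).

Definition lfun_pow (V : vectType C) (X : 'End(V)) (k : nat) : 'End(V) :=
  iter k (comp_lfun X) \1%VF.

(* here m = 1 - a_ij, where (a_ij) is the Cartan matrix *)
Definition serre (V : vectType C) (X : 'I_(rank t) -> 'End(V)) : Prop :=
  forall i j (m : nat), i != j ->
    m%:R = 1 - 2 * (alpha i, alpha j)f / (alpha i, alpha i)f ->
    \sum_(k < m.+1) ((-1) ^+ k * qbin (q_ i) m k) *:
      (lfun_pow (X i) (m - k) \o (X j \o lfun_pow (X i) k))%VF = 0.

Record Uq_relations (M : preModule) : Prop := {
  Uq_KK' : forall i, (opK M i \o opK' M i)%VF = \1%VF;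
  Uq_K'K : forall i, (opK' M i \o opK M i)%VF = \1%VF;
  Uq_KK : forall i j, (opK M i \o opK M j)%VF = (opK M j \o opK M i)%VF;
  Uq_KE : forall i j, (opK M i \o (opE M j \o opK' M i))%VF
    = qpow (alpha i, alpha j)f *: opE M j;
  Uq_KF : forall i j, (opK M i \o (opF M j \o opK' M i))%VF
    = qpow (- (alpha i, alpha j)f) *: opF M j;
  Uq_EF : forall i j, (opE M i \o opF M j)%VF - (opF M j \o opE M i)%VF
    = ((i == j)%:R / (q_ i - (q_ i)^-1)) *: (opK M i - opK' M i);
  Uq_serreE : serre (opE M);
  Uq_serreF : serre (opF M) }.

Definition weight_vector (M : preModule) (mu : hdual (cartan t)) (u : M) : Prop :=
  forall i, opK M i u = qpow (alpha i, mu)f *: u.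

Definition type1 (M : preModule) : Prop :=
  forall u : M, exists (m : nat) (mu : 'I_m -> hdual (cartan t)) (w : 'I_m -> M),
    (forall k, integral_weight (mu k) /\ weight_vector (mu k) (w k)) /\
    u = \sum_k w k.

Definition Uq_module (M : preModule) : Prop := Uq_relations M /\ type1 M.

Definition simple_module (M : preModule) : Prop :=
  [/\ Uq_module M, exists u : M, u != 0
    & forall N : {vspace M},
      (forall i u, u \in N -> [/\ opK M i u \in N, opK' M i u \in N,
                                  opE M i u \in N & opF M i u \in N]) ->
      N = 0%VS \/ N = fullv].

Definition highest_weight_vector (M : preModule) mu (u : M) : Prop :=
  [/\ u != 0, weight_vector mu u & forall i, opE M i u = 0].

Definition lowest_weight_vector (M : preModule) mu (u : M) : Prop :=
  [/\ u != 0, weight_vector mu u & forall i, opF M i u = 0].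

Record module_map (M N : preModule) (f : 'Hom(M, N)) : Prop := {
  module_mapK : forall i u, f (opK M i u) = opK N i (f u);
  module_mapK' : forall i u, f (opK' M i u) = opK' N i (f u);
  module_mapE : forall i u, f (opE M i u) = opE N i (f u);
  module_mapF : forall i u, f (opF M i u) = opF N i (f u) }.

(* the action through Delta(K) = K (x) K, Delta(E) = E (x) K + 1 (x) E,
   Delta(F) = F (x) 1 + K^-1 (x) F *)
Definition ptens (M N : preModule) : preModule := {|
  pm_sort := tens M N;
  opK := fun i => tmap (opK M i) (opK N i);
  opK' := fun i => tmap (opK' M i) (opK' N i);
  opE := fun i => tmap (opE M i) (opK N i) + tmap \1%VF (opE N i);
  opF := fun i => tmap (opF M i) \1%VF + tmap (opK' M i) (opF N i) |}.

Definition transpose (V : vectType C) (X : 'End(V)) : 'End('Hom(V, C^o)) :=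
  linfun (fun f : 'Hom(V, C^o) => (f \o X)%VF).

(* (X f)(v) = f (S(X) v) with S(K) = K^-1, S(E) = - E K^-1, S(F) = - K F *)
Definition pdual (M : preModule) : preModule := {|
  pm_sort := 'Hom(M, C^o);
  opK := fun i => transpose (opK' M i);
  opK' := fun i => transpose (opK M i);
  opE := fun i => transpose (- (opE M i \o opK' M i)%VF);
  opF := fun i => transpose (- (opK M i \o opF M i)%VF) |}.

(* [br] is total on pre-modules, but only its values on modules are
   constrained. *)
Record is_braiding
    (br : forall M N : preModule, 'Hom(ptens M N, ptens N M)) : Prop := {
  br_map : forall M N, Uq_module M -> Uq_module N -> module_map (br M N);
  br_bij : forall M N, Uq_module M -> Uq_module N -> bijective (br M N);
  br_natural : forall (M N M' N' : preModule) (f : 'Hom(M, M')) (h : 'Hom(N, N')),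
    Uq_module M -> Uq_module N -> Uq_module M' -> Uq_module N' ->
    module_map f -> module_map h ->
    (br M' N' \o tmap f h)%VF = (tmap h f \o br M N)%VF;
  br_hexagon_l : forall M N P, Uq_module M -> Uq_module N -> Uq_module P ->
    (tassoc N P M \o (br M (ptens N P) \o tassoc M N P))%VF
    = (tmap \1 (br M P) \o (tassoc N M P \o tmap (br M N) \1))%VF;
  br_hexagon_r : forall M N P, Uq_module M -> Uq_module N -> Uq_module P ->
    br (ptens M N) P
    = (tassoc P M N \o (tmap (br M P) \1 \o
        ((tassoc M P N)^-1 \o (tmap \1 (br N P) \o tassoc M N P))))%VF;
  br_norm : forall (M N : preModule) (mu nu : hdual (cartan t)) (u : M) (w : N),
    simple_module M -> simple_module N ->
    integral_weight mu -> integral_weight nu ->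
    highest_weight_vector mu u -> lowest_weight_vector nu w ->
    br M N (tpure u w) = qpow (mu, nu)f *: tpure w u }.

(* V(omega_s) with an orthonormal weight basis; N = hk_n + 1.  The conditions
   [hk_ipK], [hk_ipE], [hk_ipF] say (X u, v) = (u, X^* v) for the *-structure
   K^* = K, E^* = F K, F^* = K^-1 E. *)
Record fundModule (s : 'I_(rank t)) := FundModule {
  hk_V :> preModule;
  hk_simple : simple_module hk_V;
  hk_ip : hk_V -> hk_V -> C;
  hk_ip_linear : forall u c v w,
    hk_ip u (c *: v + w) = c * hk_ip u v + hk_ip u w;
  hk_ip_herm : forall u v, hk_ip v u = (hk_ip u v)^*;
  hk_ip_pos : forall u, u != 0 -> 0 < hk_ip u u;
  hk_ipK : forall i u v, hk_ip (opK hk_V i u) v = hk_ip u (opK hk_V i v);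
  hk_ipE : forall i u v,
    hk_ip (opE hk_V i u) v = hk_ip u (opF hk_V i (opK hk_V i v));
  hk_ipF : forall i u v,
    hk_ip (opF hk_V i u) v = hk_ip u (opK' hk_V i (opE hk_V i v));
  hk_n : nat;
  hk_v : (hk_n.+1).-tuple hk_V;
  hk_basis : basis_of fullv hk_v;
  hk_weight : forall i, exists2 mu,
    integral_weight mu & weight_vector mu (tnth hk_v i);
  hk_orthonormal : forall i j,
    hk_ip (tnth hk_v i) (tnth hk_v j) = (i == j)%:R;
  hk_highest : highest_weight_vector (omega s) (tnth hk_v ord_max) }.

End QuantumGroup.

(** * Algebras and modules given by generators and relations *)

Section Presentations.
Variable R : realType.
Local Notation C := R[i].

(* [A] is the algebra generated by the family [x] subject to [rel].  An algType
   is non-zero, which does not affect the universal property of a non-zero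
   presented algebra. *)
Definition presented_alg (I : Type)
    (rel : forall A : algType C, (I -> A) -> Prop)
    (A : algType C) (x : I -> A) : Prop :=
  rel A x /\
  forall (B : algType C) (y : I -> B), rel B y ->
    exists f : {lrmorphism A -> B}, (forall i, f (x i) = y i) /\
      forall h : {lrmorphism A -> B}, (forall i, h (x i) = y i) -> h =1 f.

Definition two_sided_ideal (A : algType C) (J : A -> Prop) : Prop :=
  [/\ J 0, forall x y, J x -> J y -> J (x + y)
    & forall a b x, J x -> J (a * x * b)].

Definition alg_quotient (A A' : algType C) (pi : {lrmorphism A -> A'})
    (X : A -> Prop) : Prop :=
  (forall y, exists x, pi x = y) /\
  forall x, pi x = 0 <->
    forall J, two_sided_ideal J -> (forall z, X z -> J z) -> J x.

Record lmod (A : algType C) := LMod {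
  lm_sort :> lmodType C;
  lact : A -> lm_sort -> lm_sort;
  lact_linearl : forall c a b x, lact (c *: a + b) x = c *: lact a x + lact b x;
  lact_linearr : forall c a x y, lact a (c *: x + y) = c *: lact a x + lact a y;
  lact1 : forall x, lact 1 x = x;
  lactA : forall a b x, lact (a * b) x = lact a (lact b x) }.

Record bimod (A : algType C) := BiMod {
  bm_lmod :> lmod A;
  ract : bm_lmod -> A -> bm_lmod;
  ract_linearl : forall c x y a, ract (c *: x + y) a = c *: ract x a + ract y a;
  ract_linearr : forall c x a b, ract x (c *: a + b) = c *: ract x a + ract x b;
  ract1 : forall x, ract x 1 = x;
  ractA : forall x a b, ract x (a * b) = ract (ract x a) b;
  lractA : forall a x b, ract (lact a x) b = lact a (ract x b) }.

Definition presented_lmod (A : algType C) (I : Type)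
    (rel : forall M : lmod A, (I -> M) -> Prop) (M : lmod A) (x : I -> M) : Prop :=
  rel M x /\
  forall (N : lmod A) (y : I -> N), rel N y ->
    exists f : {linear M -> N},
      [/\ forall a m, f (lact a m) = lact a (f m), forall i, f (x i) = y i
        & forall h : {linear M -> N},
            (forall a m, h (lact a m) = lact a (h m)) ->
            (forall i, h (x i) = y i) -> h =1 f].

(* M' = A' (x)_A M along phi, with canonical map j *)
Definition scalar_extension (A A' : algType C) (phi : {lrmorphism A -> A'})
    (M : lmod A) (M' : lmod A') (j : {linear M -> M'}) : Prop :=
  (forall a m, j (lact a m) = lact (phi a) (j m)) /\
  forall (N : lmod A') (h : {linear M -> N}),
    (forall a m, h (lact a m) = lact (phi a) (h m)) ->
    exists f : {linear M' -> N},
      [/\ forall a m, f (lact a m) = lact a (f m), forall m, f (j m) = h m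
        & forall f' : {linear M' -> N},
            (forall a m, f' (lact a m) = lact a (f' m)) ->
            (forall m, f' (j m) = h m) -> f' =1 f].

Definition sub_bimodule (A : algType C) (M : bimod A) (S : M -> Prop) : Prop :=
  [/\ S 0, forall x y, S x -> S y -> S (x + y)
    & forall a x b, S x -> S (ract (lact a x) b)].

Definition gen_sub_bimodule (A : algType C) (M : bimod A) (X : M -> Prop)
    (x : M) : Prop :=
  forall S, sub_bimodule S -> (forall z, X z -> S z) -> S x.

Definition leibniz (A : algType C) (M : bimod A) (d : {linear A -> M}) : Prop :=
  forall a b, d (a * b) = ract (d a) b + lact a (d b).

(** * First order differential calculi and differential calculi *)

Record fodc (A : algType C) := FODC {
  fo_mod :> bimod A;
  fo_d : {linear A -> fo_mod};
  fo_leibniz : leibniz fo_d;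
  fo_span : forall x : fo_mod, exists (m : nat) (a b c : 'I_m -> A),
    x = \sum_k ract (lact (a k) (fo_d (b k))) (c k) }.

(* [p] is a morphism along [phi] of bimodules and intertwines the
   differentials. *)
Record fodc_map (A A' : algType C) (phi : {lrmorphism A -> A'})
    (G : bimod A) (d : {linear A -> G}) (G' : bimod A') (d' : {linear A' -> G'})
    (p : {linear G -> G'}) : Prop := {
  fodc_map_l : forall a x, p (lact a x) = lact (phi a) (p x);
  fodc_map_r : forall x a, p (ract x a) = ract (p x) (phi a);
  fodc_map_d : forall a, p (d a) = d' (phi a) }.

(* The FODC [G'] over [A'], for a surjection phi : A -> A', is G / Lambda. *)
Definition fodc_quotient (A A' : algType C) (phi : {lrmorphism A -> A'})
    (G : bimod A) (d : {linear A -> G}) (Lambda : G -> Prop) (G' : fodc A')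
    (p : {linear G -> G'}) : Prop :=
  [/\ fodc_map phi d (fo_d G') p, forall y, exists x, p x = y
    & forall x, p x = 0 <-> Lambda x].

(* The FODC [G] over [B] is induced by [G'] along the embedding iota : B -> A.
   As [G] is spanned by the a d(b) c, the image of [p] is the span of the
   a d'(b) with a, b in B. *)
Definition fodc_induced (B A : algType C) (iota : {lrmorphism B -> A})
    (G : fodc B) (G' : fodc A) (p : {linear G -> G'}) : Prop :=
  fodc_map iota (fo_d G) (fo_d G') p /\ injective p.

(* [G] is isomorphic to the sub-bimodule of G1 (+) G2 generated by the image of
   (d1, d2); the embedding has components [p1], [p2]. *)
Definition fodc_direct_sum (B : algType C) (G1 G2 G : fodc B) : Prop :=
  exists (p1 : {linear G -> G1}) (p2 : {linear G -> G2}),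
  [/\ forall b x, p1 (lact b x) = lact b (p1 x) /\ p2 (lact b x) = lact b (p2 x),
      forall x b, p1 (ract x b) = ract (p1 x) b /\ p2 (ract x b) = ract (p2 x) b,
      forall b, p1 (fo_d G b) = fo_d G1 b /\ p2 (fo_d G b) = fo_d G2 b
    & forall x y, p1 x = p1 y -> p2 x = p2 y -> x = y].

(* A differential calculus over [B] with degree one part [G]; [dc_0] and [dc_1]
   identify [B] and [G] with the components of degree 0 and 1. *)
Record dcalc (B : algType C) (G : fodc B) := DCalc {
  dc_alg :> algType C;
  dc_gr : nat -> dc_alg -> Prop;
  dc_gr_linear : forall k c x y,
    dc_gr k x -> dc_gr k y -> dc_gr k (c *: x + y);
  dc_grM : forall k l x y, dc_gr k x -> dc_gr l y -> dc_gr (k + l) (x * y);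
  dc_gr_span : forall x, exists (m : nat) (u : 'I_m -> dc_alg),
    (forall k : 'I_m, dc_gr k (u k)) /\ x = \sum_k u k;
  dc_gr_direct : forall (m : nat) (u : 'I_m -> dc_alg),
    (forall k : 'I_m, dc_gr k (u k)) -> \sum_k u k = 0 -> forall k, u k = 0;
  dc_d : {linear dc_alg -> dc_alg};
  dc_d_gr : forall k x, dc_gr k x -> dc_gr k.+1 (dc_d x);
  dc_dd : forall x, dc_d (dc_d x) = 0;
  dc_leibniz : forall k x y, dc_gr k x ->
    dc_d (x * y) = dc_d x * y + (-1) ^+ k * (x * dc_d y);
  dc_0 : {lrmorphism B -> dc_alg};
  dc_0_inj : injective dc_0;
  dc_0_im : forall x, dc_gr 0 x <-> exists b, dc_0 b = x;
  dc_1 : {linear G -> dc_alg};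
  dc_1_inj : injective dc_1;
  dc_1_im : forall x, dc_gr 1 x <-> exists w, dc_1 w = x;
  dc_1_l : forall b w, dc_1 (lact b w) = dc_0 b * dc_1 w;
  dc_1_r : forall w b, dc_1 (ract w b) = dc_1 w * dc_0 b;
  dc_1_d : forall b, dc_1 (fo_d G b) = dc_d (dc_0 b);
  dc_generated : forall S : dc_alg -> Prop,
    (forall b, S (dc_0 b)) -> (forall b, S (dc_d (dc_0 b))) ->
    (forall x y, S x -> S y -> S (x + y)) ->
    (forall x y, S x -> S y -> S (x * y)) -> forall x, S x }.

Definition universal_dcalc (B : algType C) (G : fodc B) (W : dcalc G) : Prop :=
  forall W' : dcalc G, exists f : {lrmorphism W -> W'},
  [/\ forall k x, dc_gr k x -> dc_gr k (f x),
      forall x, f (dc_d W x) = dc_d W' (f x),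
      forall b, f (dc_0 W b) = dc_0 W' b,
      forall w, f (dc_1 W w) = dc_1 W' w
    & forall y, exists x, f x = y].

Record star_structure (A : algType C) (st : A -> A) : Prop := {
  star_add : forall x y, st (x + y) = st x + st y;
  star_scale : forall (c : C) x, st (c *: x) = c^* *: st x;
  star_mul : forall x y, st (x * y) = st y * st x;
  star_inv : forall x, st (st x) = x }.

(* the *-structure [st] of [B] extends to the differential calculus *)
Definition differential_star_calculus (B : algType C) (st : B -> B)
    (G : fodc B) (W : dcalc G) : Prop :=
  exists star : W -> W,
  [/\ forall b, star (dc_0 W b) = dc_0 W (st b),
      (forall x y, star (x + y) = star x + star y) /\
      (forall (c : C) x, star (c *: x) = c^* *: star x),
      forall x, star (star x) = x,
      forall x, star (dc_d W x) = dc_d W (star x)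
    & forall k l x y, dc_gr k x -> dc_gr l y ->
        star (x * y) = (-1) ^+ (k * l) * (star y * star x)].

End Presentations.

(** * The Heckenberger-Kolb calculi *)

Section HeckenbergerKolb.
Variables (R : realType) (g : simpleLie R) (t : cartanData g) (q : R).
Variable br : forall M N : preModule t, 'Hom(ptens M N, ptens N M).
Variables (s : 'I_(rank t)) (V : fundModule q s).
Local Notation C := R[i].
Local Notation N := (hk_n V).+1.
Local Notation qpow := (qpow q).

Definition hk_f : N.-tuple (pdual V) :=
  [tuple linfun (coord (hk_v V) i : V -> C^o) | i < N].

Definition oo : C := hform (omega s) (omega s).
Definition aa : C := hform (alpha s) (alpha s).

Local Notation v := (hk_v V).
Local Notation f := hk_f.
Local Notation dV := (pdual V).

Definition RVV := components v v v v (br V V).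
Definition RDD := components f f f f (br dV dV).
Definition RVD := components v f f v (br V dV).
Definition RDD' := components f f f f (br dV dV)^-1%VF.
Definition RVD' := components f v v f (br V dV)^-1%VF.

Definition PQV := components v v v v
  ((br V V - qpow oo *: \1) \o (br V V + qpow (oo - aa) *: \1))%VF.
Definition PQD := components f f f f
  ((br dV dV - qpow oo *: \1) \o (br dV dV + qpow (oo - aa) *: \1))%VF.

(* sum_{k,l} T^{ij}_{kl} X_{kl} *)
Definition tsum (M : lmodType C) (T : 'I_N -> 'I_N -> 'I_N -> 'I_N -> C)
    (X : 'I_N -> 'I_N -> M) (i j : 'I_N) : M :=
  \sum_k \sum_l T i j k l *: X k l.

Definition rel_plus (A : algType C) (x : 'I_N -> A) : Prop :=
  forall i j, x i * x j = qpow (- oo) *: tsum RVV (fun k l => x k * x l) i j.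

Definition rel_minus (A : algType C) (y : 'I_N -> A) : Prop :=
  forall i j, y i * y j = qpow (- oo) *: tsum RDD (fun k l => y k * y l) i j.

Definition rel_exchange (A : algType C) (x y : 'I_N -> A) : Prop :=
  forall i j, y i * x j = qpow oo *: tsum RVD (fun k l => x k * y l) i j.

(* A_C = A_+ (x) A_- with its exchange relations, on the generators
   f^i = z (inl i), v^i = z (inr i) *)
Definition rel_AC (A : algType C) (z : 'I_N + 'I_N -> A) : Prop :=
  [/\ rel_plus (fun i => z (inl i)), rel_minus (fun i => z (inr i))
    & rel_exchange (fun i => z (inl i)) (fun i => z (inr i))].

(* The span of the monomials in the z's of degree [k]. *)
Definition degree_part (A : algType C) (z : 'I_N + 'I_N -> A) (k : int)
    (x : A) : Prop :=
  exists (m : nat) (c : 'I_m -> C) (w : 'I_m -> seq ('I_N + 'I_N)),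
    (forall a, \sum_(u <- w a) (if u is inl _ then -1 else 1) = k :> int) /\
    x = \sum_a c a *: \prod_(u <- w a) z u.

Record hkAlgebras := HKAlgebras {
  Ap : algType C;
  Ap_f : 'I_N -> Ap;
  Ap_presented : presented_alg rel_plus Ap_f;
  Am : algType C;
  Am_v : 'I_N -> Am;
  Am_presented : presented_alg rel_minus Am_v;
  ACx : algType C;
  AC_z : 'I_N + 'I_N -> ACx;
  AC_presented : presented_alg rel_AC AC_z;
  ApC : {lrmorphism Ap -> ACx};
  ApC_f : forall i, ApC (Ap_f i) = AC_z (inl i);
  AmC : {lrmorphism Am -> ACx};
  AmC_v : forall i, AmC (Am_v i) = AC_z (inr i);
  AC_c : ACx := \sum_i AC_z (inr i) * AC_z (inl i);
  AA : algType C;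
  AA_pi : {lrmorphism ACx -> AA};
  AA_quotient : alg_quotient AA_pi (fun x => x = AC_c - 1);
  AA_z : 'I_N + 'I_N -> AA := fun u => AA_pi (AC_z u);
  BB : algType C;
  BB_iota : {lrmorphism BB -> AA};
  BB_inj : injective BB_iota;
  BB_im : forall x, degree_part AA_z 0 x <-> exists b, BB_iota b = x }.

Section Calculi.
Variable H : hkAlgebras.
Local Notation xC i := (AC_z H (inl i)).
Local Notation yC i := (AC_z H (inr i)).
Local Notation c := (AC_c H).

(* the sub-bimodule Lambda_+ or Lambda_- *)
Definition hk_Lambda (G : bimod (ACx H)) (d : {linear ACx H -> G}) : G -> Prop :=
  gen_sub_bimodule (fun z : G =>
    [\/ z = d c, exists w : G, z = lact (c - 1) w
      | exists w : G, z = ract w (c - 1)]).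

Record hkDel := HKDel {
  Gp : bimod (Ap H);
  Gp_df : 'I_N -> Gp;
  Gp_presented : presented_lmod (fun (M : lmod (Ap H)) (m : 'I_N -> M) =>
      forall k l, tsum PQV (fun i j => lact (Ap_f H i) (m j)) k l = 0) Gp_df;
  Gp_ract : forall i j, ract (Gp_df i) (Ap_f H j)
    = qpow (aa - oo) *: tsum RVV (fun k l => lact (Ap_f H k) (Gp_df l)) i j;
  GpC : bimod (ACx H);
  GpC_j : {linear Gp -> GpC};
  GpC_ext : scalar_extension (ApC H) GpC_j;
  GpC_j_ract : forall w a, GpC_j (ract w a) = ract (GpC_j w) (ApC H a);
  GpC_ract : forall i j, ract (GpC_j (Gp_df i)) (yC j)
    = qpow (- oo) *: tsum RVD' (fun k l => lact (yC k) (GpC_j (Gp_df l))) i j;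
  del : {linear ACx H -> GpC};
  del_leibniz : leibniz del;
  del_f : forall i, del (xC i) = GpC_j (Gp_df i);
  del_v : forall i, del (yC i) = 0;
  GpA : fodc (AA H);
  GpA_p : {linear GpC -> GpA};
  GpA_quotient : fodc_quotient (AA_pi H) del (hk_Lambda del) GpA_p;
  Gdel : fodc (BB H);
  Gdel_j : {linear Gdel -> GpA};
  Gdel_induced : fodc_induced (BB_iota H) Gdel_j }.

Record hkDelbar := HKDelbar {
  Gm : bimod (Am H);
  Gm_dv : 'I_N -> Gm;
  Gm_presented : presented_lmod (fun (M : lmod (Am H)) (m : 'I_N -> M) =>
      forall k l, tsum PQD (fun i j => lact (Am_v H i) (m j)) k l = 0) Gm_dv;
  Gm_ract : forall i j, ract (Gm_dv i) (Am_v H j)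
    = qpow (oo - aa) *: tsum RDD' (fun k l => lact (Am_v H k) (Gm_dv l)) i j;
  GmC : bimod (ACx H);
  GmC_j : {linear Gm -> GmC};
  GmC_ext : scalar_extension (AmC H) GmC_j;
  GmC_j_ract : forall w a, GmC_j (ract w a) = ract (GmC_j w) (AmC H a);
  GmC_ract : forall i j, ract (GmC_j (Gm_dv i)) (xC j)
    = qpow oo *: tsum RVD (fun k l => lact (xC k) (GmC_j (Gm_dv l))) i j;
  delbar : {linear ACx H -> GmC};
  delbar_leibniz : leibniz delbar;
  delbar_f : forall i, delbar (xC i) = 0;
  delbar_v : forall i, delbar (yC i) = GmC_j (Gm_dv i);
  GmA : fodc (AA H);
  GmA_p : {linear GmC -> GmA};
  GmA_quotient : fodc_quotient (AA_pi H) delbar (hk_Lambda delbar) GmA_p;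
  Gdelbar : fodc (BB H);
  Gdelbar_j : {linear Gdelbar -> GmA};
  Gdelbar_induced : fodc_induced (BB_iota H) Gdelbar_j }.

(* the *-structure of B, given by (f^i v^j)^* = f^j v^i *)
Definition hk_star (st : BB H -> BB H) : Prop :=
  star_structure st /\
  forall i j b b',
    BB_iota H b = AA_z H (inl i) * AA_z H (inr j) ->
    BB_iota H b' = AA_z H (inl j) * AA_z H (inr i) -> st b = b'.

End Calculi.
End HeckenbergerKolb.

(* Main.v *)
Require Import Defs.
From HB Require Import structures.
From mathcomp Require Import all_boot all_order all_algebra.
From mathcomp.real_closed Require Import complex.
From mathcomp Require Import boolp reals exp.
From mathcomp Require Import zify ring.

Set Implicit Arguments.
Unset Strict Implicit.
Unset Printing Implicit Defensive.

Import Order.TTheory GRing.Theory Num.Theory.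
Local Open Scope ring_scope.

(** The universal calculus inherits an involution from its first order part.
    Suppose the *-structure of B extends to the FODC Gamma_d.  The universal
    calculus, with its product reversed, its scalars conjugated, and B and
    Gamma_d embedded through their involutions, is again a calculus with first
    order part Gamma_d; universality gives a map to it, and this map is, up to
    a sign in each degree, the involution of the calculus ([universal_star]).  On Gamma_d the only
    possible involution is a d(b) c |-> c^* d(b^* ) a^*, so the point is that
    it is well defined ([fodc_star_exists]), and since Gamma_d sits in the sum
    of Gamma_del and Gamma_delbar it suffices that the star exchanges these two.

    This exchange already happens before passing to quotients.  The relations
    of A_C, of Gamma_{+,C} and of Gamma_{-,C} are written with the braidings of
    V and V^*, and f^i <-> v^i, df^i <-> dv^i turns each relation of one
    calculus into one of the other as soon as complex conjugation acts on the
    braiding coefficients by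
      conj (R_{V,V})^{kl}_{ij} = (R_{V^*,V^*})^{lk}_{ji},
      conj (R_{V,V^*})^{kl}_{ij} = (R_{V,V^*})^{lk}_{ji}.
    The universal properties of the presented modules then give antilinear
    bimodule maps both ways ([theta_exists]).  They preserve the sub-bimodules
    Lambda because c^* = c, and so descend ([star_rel_descent]); on B they
    induce the given star because B is generated by the f^i v^j
    ([degree0_word], [B_lift]).

    The two identities express that the braiding is compatible with the
    *-structure of U_q(g).  The Riesz map J : V -> V^*, v |-> (v, -), is
    antilinear and intertwines the action through tau = S^{-1} o *, an
    antilinear automorphism which reverses the coproduct and exchanges E_i and
    F_i up to scalars ([twist], [riesz_twist]).  Hence conjugating a braiding by
    J, with the tensor factors flipped, gives again a module map.  A highest
    weight vector tensor a lowest weight vector generates the tensor product of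
    two simple modules ([tensor_cyclic]), and J exchanges highest and lowest
    weight vectors, so that both maps agree on a generator by the normalization
    of the braiding ([braiding_flip]).  The lowest weight vector of V is found
    without any Weyl group: for the inner product, the images of the highest
    weight vector under words of different lengths in the F_i are orthogonal,
    so that all long words kill it ([word_span_orthogonal],
    [lowest_weight_exists]). *)

(** * Conjugate structures and presented algebras *)

Section Conjugates.
Variable R : realType.
Local Notation C := R[i].

Definition antilinear (U W : lmodType C) (f : U -> W) : Prop :=
  (forall x y, f (x + y) = f x + f y) /\ (forall c x, f (c *: x) = c^* *: f x).

Definition conj_mod (M : lmodType C) : Type := M.

Section ConjMod.
Variable M : lmodType C.
HB.instance Definition _ := GRing.Zmodule.on (conj_mod M).
Let cscale (c : C) (x : conj_mod M) : conj_mod M := (c^* : C) *: (x : M).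
Let cscaleA a b v : cscale a (cscale b v) = cscale (a * b) v.
Proof. by rewrite /cscale scalerA rmorphM. Qed.
Let cscale1 : left_id 1 cscale.
Proof. by move=> v; rewrite /cscale rmorph1 scale1r. Qed.
Let cscaleDr : right_distributive cscale +%R.
Proof. by move=> c x y; rewrite /cscale scalerDr. Qed.
Let cscaleDl v : {morph cscale^~ v : a b / a + b}.
Proof. by move=> a b; rewrite /cscale rmorphD scalerDl. Qed.
HB.instance Definition _ := GRing.Zmodule_isLmodule.Build C (conj_mod M)
  cscaleA cscale1 cscaleDr cscaleDl.
End ConjMod.

Definition antimorphism (A B : algType C) (f : A -> B) : Prop :=
  [/\ antilinear f, f 1 = 1 & forall a b, f (a * b) = f b * f a].

(** Linear multiplicative maps into [conj_op A] are the antilinear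
    antimultiplicative maps into [A]; a *-structure on a presented algebra is
    thus obtained from its universal property. *)
Definition conj_op (A : algType C) : Type := A.

Section ConjOp.
Variable A : algType C.
HB.instance Definition _ := GRing.NzRing.copy (conj_op A) (A^c).
HB.instance Definition _ := GRing.Lmodule.copy (conj_op A) (conj_mod A).
Let cscaleAl (a : C) (x y : conj_op A) : a *: (x * y) = a *: x * y.
Proof. exact: (scalerAr (a^*) (y : A) (x : A)). Qed.
HB.instance Definition _ := GRing.Lmodule_isLalgebra.Build C (conj_op A) cscaleAl.
Let cscaleAr (a : C) (x y : conj_op A) : a *: (x * y) = x * (a *: y).
Proof. exact: (scalerAl (a^*) (y : A) (x : A)). Qed.
HB.instance Definition _ := GRing.Lalgebra_isAlgebra.Build C (conj_op A) cscaleAr.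
End ConjOp.

Lemma conj_opZ (A : algType C) (c : C) (x : A) :
  c *: (x : conj_op A) = (c^* *: x : A).
Proof. by []. Qed.
Lemma conj_opM (A : algType C) (x y : A) :
  (x : conj_op A) * (y : conj_op A) = (y * x : A).
Proof. by []. Qed.

Lemma lrmorphism_conj_op (A B : algType C) (f : {lrmorphism A -> conj_op B}) :
  antimorphism (f : A -> B).
Proof.
split; first split; first exact: (rmorphD f).
- exact: (linearZ_LR f).
- exact: (rmorph1 f).
- by move=> x y; rewrite (rmorphM f).
Qed.

Definition subalgebra (A : algType C) (S : A -> Prop) : Prop :=
  [/\ S 1, forall c x y, S x -> S y -> S (c *: x + y)
    & forall x y, S x -> S y -> S (x * y)].

Section Subalgebra.
Variables (A : algType C) (S : A -> Prop) (hS : subalgebra S).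

Definition subalg_pred (_ : subalgebra S) : {pred A} := fun x => `[< S x >].

Lemma subalg_predP x : reflect (S x) (x \in subalg_pred hS).
Proof. exact: asboolP. Qed.

Lemma subalg_pred_closed : subalg_closed (subalg_pred hS).
Proof.
case: hS => h1 hlin hM; split.
- exact/subalg_predP.
- by move=> c x y /subalg_predP hx /subalg_predP hy; apply/subalg_predP/hlin.
- by move=> x y /subalg_predP hx /subalg_predP hy; apply/subalg_predP/hM.
Qed.

Record subalg := SubAlg
  { subalg_val : A; subalg_prop : subalg_val \in subalg_pred hS }.
HB.instance Definition _ := [isSub for subalg_val].
HB.instance Definition _ := [Choice of subalg by <:].
HB.instance Definition _ := GRing.SubChoice_isSubAlgebra.Build C A
  (subalg_pred hS) subalg (GRing.subalg_closed_semi subalg_pred_closed).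

HB.instance Definition _ := GRing.Linear.copy subalg_val
  (val : subalg -> A).
HB.instance Definition _ := GRing.RMorphism.copy subalg_val
  (val : subalg -> A).

End Subalgebra.

(** Corestricting the generators to the subalgebra [S] and including back gives
    an endomorphism fixing the generators, hence the identity by uniqueness.
    The generators satisfy the relations inside [S] because relations are
    reflected by injective morphisms. *)
Lemma presented_alg_ind (I : Type)
    (rel : forall A : algType C, (I -> A) -> Prop) (A : algType C) (x : I -> A) :
  (forall (A' B : algType C) (h : {lrmorphism A' -> B}) (y : I -> A'),
     injective h -> rel B (h \o y) -> rel A' y) ->
  presented_alg rel x ->
  forall S, subalgebra S -> (forall i, S (x i)) -> forall a, S a.
Proof.
move=> hrel [hx huniv] S hS hSx a.
pose y i : subalg hS := SubAlg (introT (subalg_predP hS (x i)) (hSx i)).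
pose v : {lrmorphism subalg hS -> A} := @subalg_val A S hS.
have [f [fx _]] := huniv (subalg hS : algType C) y
  (hrel _ _ v y val_inj hx).
have [k [_ kuniq]] := huniv A x hx.
have e1 := kuniq (v \o f : {lrmorphism A -> A}) (fun i => congr1 v (fx i)).
have e2 := kuniq (idfun : {lrmorphism A -> A}) (fun i => erefl).
have := valP (f a); rewrite -[val (f a)]/((v \o f) a) e1 -e2.
by move/subalg_predP.
Qed.

End Conjugates.

(** * Involutions of calculi *)

Section Actions.
Variables (R : realType).
Local Notation C := R[i].
Variable (A : algType C).

HB.instance Definition _ (M : lmod A) (a : A) :=
  GRing.isLinear.Build C M M *:%R (lact a) (fun c x y => lact_linearr c a x y).
HB.instance Definition _ (M : bimod A) (x : M) :=
  GRing.isLinear.Build C A M *:%R (ract x) (fun c a b => ract_linearr c x a b).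

Lemma lactDl (M : lmod A) (a b : A) (x : M) :
  lact (a + b) x = lact a x + lact b x.
Proof. by rewrite -[a]scale1r lact_linearl !scale1r. Qed.
Lemma lact0l (M : lmod A) (x : M) : lact 0 x = 0.
Proof. by apply: (addrI (lact 0 x)); rewrite -lactDl !addr0. Qed.
Lemma lactZl (M : lmod A) c (a : A) (x : M) : lact (c *: a) x = c *: lact a x.
Proof. by rewrite -[c *: a]addr0 lact_linearl lact0l addr0. Qed.
Lemma ractDl (M : bimod A) (x y : M) (a : A) :
  ract (x + y) a = ract x a + ract y a.
Proof. by rewrite -[x]scale1r ract_linearl !scale1r. Qed.
Lemma ract0l (M : bimod A) (a : A) : ract (0 : M) a = 0.
Proof. by apply: (addrI (ract (0 : M) a)); rewrite -ractDl !addr0. Qed.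
Lemma ractZl (M : bimod A) c (x : M) (a : A) : ract (c *: x) a = c *: ract x a.
Proof. by rewrite -[c *: x]addr0 ract_linearl ract0l addr0. Qed.
End Actions.

Section StarCalculus.
Variable R : realType.
Local Notation C := R[i].
Variables (B : algType C) (st : B -> B) (hst : star_structure st).

Lemma star1 : st 1 = 1.
Proof. by rewrite -[LHS]mulr1 -{2}(star_inv hst 1) -(star_mul hst) mulr1 star_inv. Qed.

(** The candidate for the involution, as a relation because an element has many
    expressions as a sum of products a d(b) c, and with values in a second
    calculus so as to compare Gamma_del with Gamma_delbar. *)
Inductive star_rel (G1 G2 : fodc B) : G1 -> G2 -> Prop :=
| star_rel0 : star_rel 0 0
| star_relS x y a b c : star_rel x y ->
    star_rel (x + ract (lact a (fo_d G1 b)) c)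
             (y + ract (lact (st c) (fo_d G2 (st b))) (st a)).

Section OneStar.
Variable G : fodc B.
Local Notation rel := (@star_rel G G).

Lemma star_relD x y x' y' : rel x y -> rel x' y' -> rel (x + x') (y + y').
Proof.
move=> h; elim=> [|u v a b c _ IH]; first by rewrite !addr0.
by rewrite !addrA; apply: star_relS.
Qed.

Lemma star_rel_term a b c :
  rel (ract (lact a (fo_d G b)) c)
      (ract (lact (st c) (fo_d G (st b))) (st a)).
Proof. by rewrite -[X in rel X]add0r -[X in rel _ X]add0r; do 2!constructor. Qed.

Lemma star_relZ k x y : rel x y -> rel (k *: x) (k^* *: y).
Proof.
elim=> [|u v a b c _ IH]; first by rewrite !scaler0; constructor.
rewrite !scalerDr; apply: star_relD => //.
rewrite -ractZl -lactZl -linearZ /= -(star_scale hst).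
exact: star_rel_term.
Qed.

Lemma star_rel_l k x y : rel x y -> rel (lact k x) (ract y (st k)).
Proof.
elim=> [|u v a b c _ IH]; first by rewrite linear0 ract0l; constructor.
rewrite linearD ractDl; apply: star_relD => //=.
rewrite -lractA -lactA -ractA -(star_mul hst).
exact: star_rel_term.
Qed.

Lemma star_rel_r k x y : rel x y -> rel (ract x k) (lact (st k) y).
Proof.
elim=> [|u v a b c _ IH]; first by rewrite linear0 ract0l; constructor.
rewrite linearD ractDl; apply: star_relD => //=.
rewrite -lractA -lactA -ractA -(star_mul hst).
exact: star_rel_term.
Qed.

Lemma star_rel_sym x y : rel x y -> rel y x.
Proof.
elim=> [|u v a b c _ IH]; first by constructor.
apply: star_relD => //.
rewrite -{2}(star_inv hst a) -{2}(star_inv hst b) -{2}(star_inv hst c).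
exact: star_rel_term.
Qed.

Lemma star_rel_d b : rel (fo_d G b) (fo_d G (st b)).
Proof.
have := star_rel_term 1 b 1.
by rewrite star1 !lact1 !ract1.
Qed.

Lemma star_rel_total x : exists y, rel x y.
Proof.
have [m [a [b [c ->]]]] := fo_span x.
apply: (big_ind (fun x => exists y, rel x y)); first by exists 0; constructor.
  by move=> u v [u' hu] [v' hv]; exists (u' + v'); apply: star_relD.
by move=> k _; eexists; apply: star_rel_term.
Qed.

Definition fodc_star (sg : G -> G) : Prop :=
  [/\ antilinear sg, cancel sg sg,
      forall b x, sg (lact b x) = ract (sg x) (st b),
      forall b x, sg (ract x b) = lact (st b) (sg x)
    & forall b, sg (fo_d G b) = fo_d G (st b)].

(** [star_rel] is a total additive relation, so it is the graph of a map as
    soon as 0 is related to nothing but 0. *)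
Lemma fodc_star_exists : (forall y, rel 0 y -> y = 0) ->
  exists sg, fodc_star sg.
Proof.
move=> hwd.
have [sg hsg] := choice star_rel_total.
have uniq x y : rel x y -> sg x = y.
  move=> hxy; apply/eqP; rewrite -subr_eq0; apply/eqP/hwd.
  have := star_relD (hsg x) (star_relZ (-1) hxy).
  by rewrite rmorphN1 !scaleN1r subrr.
exists sg; split; first split.
- by move=> x y; apply/uniq/star_relD.
- by move=> c x; apply/uniq/star_relZ.
- by move=> x; apply/uniq/star_rel_sym.
- by move=> b x; apply/uniq/star_rel_l.
- by move=> b x; apply/uniq/star_rel_r.
- by move=> b; apply/uniq/star_rel_d.
Qed.
End OneStar.

Lemma mulr_signZ (A : algType C) k (x : A) :
  (-1) ^+ k * x = (-1 : C) ^+ k *: x.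
Proof. by rewrite -signr_odd mulr_sign -[in RHS]signr_odd scaler_sign. Qed.

Section Calculus.
Variables (G : fodc B) (W : dcalc G).

Lemma dc_grZ k c (x : W) : dc_gr k x -> dc_gr k (c *: x).
Proof.
move=> hx; have := dc_gr_linear (c - 1) hx hx.
by rewrite scalerBl scale1r subrK.
Qed.

Lemma dc_gr0 k : @dc_gr _ _ _ W k 0.
Proof.
suff [x /(dc_grZ 0)] : exists x, @dc_gr _ _ _ W k x by rewrite scale0r.
elim: k => [|k [x /dc_d_gr hx]]; last by exists (dc_d W x).
by exists (dc_0 W 0); apply/dc_0_im; exists 0.
Qed.

Lemma dc_grD k (x y : W) : dc_gr k x -> dc_gr k y -> dc_gr k (x + y).
Proof. by move=> hx hy; rewrite -[x]scale1r; apply: dc_gr_linear. Qed.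

Lemma dc_hom_ind (P : W -> Prop) : (forall x y, P x -> P y -> P (x + y)) ->
  (forall k x, dc_gr k x -> P x) -> forall x, P x.
Proof.
move=> hD hP x; have [m [u [hu ->]]] := dc_gr_span x.
apply: (big_ind P) => // [|i _]; last exact: hP (hu i).
exact: hP (dc_gr0 0).
Qed.

(** The homogeneous components of [x], as a sequence vanishing in all large
    degrees, so that elements with components in different ranges can be added. *)
Definition decomp (x : W) (u : nat -> W) : Prop :=
  (forall k, dc_gr k (u k)) /\
  exists m, forall n, (m <= n)%N -> x = \sum_(k < n) u k.

Lemma decomp_exists x : exists u, decomp x u.
Proof.
apply: (dc_hom_ind (P := fun x => exists u, decomp x u)) => {x}.
  move=> x y [u [hu [m em]]] [v [hv [n en]]].
  exists (fun k => u k + v k); split=> [k|]; first exact: dc_grD.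
  exists (maxn m n) => l; rewrite geq_max => /andP[hm hn].
  by rewrite big_split /= -em // -en.
move=> k x hx; exists (fun l => if l == k then x else 0); split.
  by move=> l; case: eqP => [->//|_]; apply: dc_gr0.
exists k.+1 => n hn; rewrite (bigD1 (Ordinal hn)) //= eqxx big1 ?addr0 //.
by move=> i; rewrite -val_eqE /= => /negPf ->.
Qed.

Lemma decomp0 u : decomp 0 u -> forall k, u k = 0.
Proof.
move=> [hu [m em]] k.
have := em (maxn m k.+1) (leq_maxl _ _); move/esym.
move/(dc_gr_direct (fun i => hu i)).
by move/(_ (Ordinal (leq_maxr m k.+1))).
Qed.

Lemma decomp_lin c x y u v : decomp x u -> decomp y v ->
  decomp (c *: x + y) (fun k => c *: u k + v k).
Proof.
move=> [hu [m em]] [hv [n en]]; split=> [k|]; first exact: dc_gr_linear.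
exists (maxn m n) => l; rewrite geq_max => /andP[hm hn].
by rewrite big_split /= -scaler_sumr -em // -en.
Qed.

Lemma decomp_uniq x u v : decomp x u -> decomp x v -> u =1 v.
Proof.
move=> hu hv k; apply/eqP; rewrite -subr_eq0; apply/eqP.
have := decomp0 (u := fun k => -1 *: v k + u k) _ k.
rewrite scaleN1r addrC; apply.
by rewrite -[0](subrr x) addrC -scaleN1r; apply: decomp_lin.
Qed.

Lemma degree_twist (e : nat -> C) : exists T : {linear W -> W},
  forall k x, dc_gr k x -> T x = e k *: x.
Proof.
have [u hu] := choice decomp_exists.
pose Q x y := exists m, forall n, (m <= n)%N -> y = \sum_(k < n) e k *: u x k.
have Qex x : exists y, Q x y.
  have [_ [m em]] := hu x; exists (\sum_(k < m) e k *: u x k); exists m => n hn.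
  rewrite -(subnKC hn) big_split_ord /= [X in _ + X]big1 ?addr0 // => i _.
  have e1 : \sum_(k < (m + i.+1)) u x k = \sum_(k < (m + i)) u x k.
    by rewrite -!em // leq_addr.
  move: e1; rewrite addnS big_ord_recr /= -[X in _ = X]addr0 => /addrI ->.
  exact: scaler0.
have [T hT] := choice Qex.
have Tuniq x y : Q x y -> T x = y.
  case: (hT x) => m em [n en].
  by rewrite (em (maxn m n)) ?leq_maxl // (en (maxn m n)) ?leq_maxr.
have Tlin : linear T.
  move=> c x y; apply: Tuniq.
  case: (hT x) => m em; case: (hT y) => n en; exists (maxn m n) => l.
  rewrite geq_max => /andP[/em -> /en ->].
  rewrite scaler_sumr -big_split /=; apply: eq_bigr => i _.
  rewrite (decomp_uniq (hu _) (decomp_lin c (hu x) (hu y)) i).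
  by rewrite scalerDr !scalerA mulrC.
exists (HB.pack_for {linear W -> W} T (GRing.isLinear.Build C W W *:%R T Tlin)).
move=> k x hx; apply: Tuniq.
have hd : decomp x (fun l => if l == k then x else 0).
  split=> [l|]; first by case: eqP => [->//|_]; apply: dc_gr0.
  exists k.+1 => n hn; rewrite (bigD1 (Ordinal hn)) //= eqxx big1 ?addr0 //.
  by move=> i; rewrite -val_eqE /= => /negPf ->.
exists k.+1 => n hn; rewrite (bigD1 (Ordinal hn)) //= big1 ?addr0.
  by rewrite (decomp_uniq (hu x) hd) eqxx.
move=> i; rewrite -val_eqE /= (decomp_uniq (hu x) hd) => /negPf ->.
by rewrite scaler0.
Qed.

(** With the grading involution, the graded Leibniz rule and graded signs can be
    written for all elements, not only homogeneous ones. *)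
Definition is_parity (sigma : W -> W) : Prop :=
  [/\ forall k x, dc_gr k x -> sigma x = (-1) ^+ k *: x,
      {morph sigma : x y / x * y},
      cancel sigma sigma,
      forall x y, dc_d W (x * y) = dc_d W x * y + sigma x * dc_d W y
    & forall x, dc_d W (sigma x) = - sigma (dc_d W x)].

Lemma dc_parity : exists sigma : {linear W -> W}, is_parity sigma.
Proof.
have [sigma hsigma] := degree_twist (fun k => (-1) ^+ k).
exists sigma; split=> //.
- elim/dc_hom_ind => [x x' hx hx' y|k x hx].
    by rewrite mulrDl !linearD /= hx hx' mulrDl.
  elim/dc_hom_ind => [y y' hy hy'|l y hy].
    by rewrite mulrDr !linearD /= hy hy' mulrDr.
  rewrite (hsigma _ _ hx) (hsigma _ _ hy) (hsigma _ _ (dc_grM hx hy)).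
  by rewrite -scalerAl -scalerAr scalerA exprD.
- elim/dc_hom_ind => [x y hx hy|k x hx]; first by rewrite !linearD /= hx hy.
  rewrite (hsigma _ _ hx) linearZ /= (hsigma _ _ hx) scalerA -expr2.
  by rewrite sqrr_sign scale1r.
- elim/dc_hom_ind => [x x' hx hx' y|k x hx y].
    by rewrite mulrDl !linearD /= hx hx' !mulrDl addrACA.
  by rewrite (dc_leibniz _ hx) (hsigma _ _ hx) mulr_signZ scalerAl.
- elim/dc_hom_ind => [x y hx hy|k x hx].
    by rewrite !linearD /= hx hy.
  rewrite (hsigma _ _ hx) (hsigma _ _ (dc_d_gr hx)) linearZ /=.
  by rewrite exprS mulN1r scaleNr opprK.
Qed.

Lemma bin2D k l : 'C(k + l, 2) = ('C(k, 2) + 'C(l, 2) + k * l)%N.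
Proof.
elim: l => [|l IH]; first by rewrite !addn0 muln0 addn0.
by rewrite addnS !binS !bin1 IH mulnS; lia.
Qed.

(** A calculus with the product reversed and the scalars conjugated.  The product
    is reversed without the sign (-1)^{kl}: that sign is absorbed by rescaling
    degree k by (-1)^{k(k-1)/2}, at the price of composing the differential with
    the grading involution. *)
Section ConjCalculus.
Variables (sg : G -> G) (hsg : fodc_star sg).
Variables (sigma : {linear W -> W}) (hsigma : is_parity sigma).

Definition conj_d (x : conj_op W) : conj_op W := dc_d W (sigma x).
Fact conj_d_linear : linear conj_d.
Proof. by move=> c x y; rewrite /conj_d !conj_opZ !linearD !linearZ. Qed.
HB.instance Definition _ :=
  GRing.isLinear.Build C (conj_op W) (conj_op W) *:%R conj_d conj_d_linear.

Definition conj_0 (b : B) : conj_op W := dc_0 W (st b).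
Fact conj_0_linear : linear conj_0.
Proof.
by move=> c x y; rewrite /conj_0 (star_add hst) (star_scale hst) linearD linearZ.
Qed.
Fact conj_0_monoid : monoid_morphism conj_0.
Proof.
split; first by rewrite /conj_0 star1 rmorph1.
by move=> x y; rewrite /conj_0 (star_mul hst) rmorphM.
Qed.
HB.instance Definition _ :=
  GRing.isLinear.Build C B (conj_op W) *:%R conj_0 conj_0_linear.
HB.instance Definition _ :=
  GRing.isMonoidMorphism.Build B (conj_op W) conj_0 conj_0_monoid.

Definition conj_1 (w : G) : conj_op W := dc_1 W (sg w).
Fact conj_1_linear : linear conj_1.
Proof.
by move: hsg => [[sgD sgZ] _ _ _ _] c x y; rewrite /conj_1 sgD sgZ linearD linearZ.
Qed.
HB.instance Definition _ :=
  GRing.isLinear.Build C G (conj_op W) *:%R conj_1 conj_1_linear.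

Let gr k (x : conj_op W) : Prop := dc_gr k (x : W).

Fact conj_gr_linear k c x y : gr k x -> gr k y -> gr k (c *: x + y).
Proof. exact: dc_gr_linear. Qed.
Fact conj_grM k l x y : gr k x -> gr l y -> gr (k + l) (x * y).
Proof. by move=> hx hy; rewrite addnC; apply: dc_grM. Qed.
Fact conj_d_gr k x : gr k x -> gr k.+1 (conj_d x).
Proof.
move=> hx; apply: dc_d_gr; case: hsigma => /(_ _ _ hx) -> _ _ _ _.
exact: dc_grZ.
Qed.
Fact conj_dd x : conj_d (conj_d x) = 0.
Proof. by rewrite /conj_d; case: hsigma => _ _ _ _ ->; rewrite dc_dd linear0; apply: oppr0. Qed.
Fact conj_leibniz k x y : gr k x ->
  conj_d (x * y) = conj_d x * y + (-1) ^+ k * (x * conj_d y).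
Proof.
case: hsigma => sE sM sK dM ds hx; rewrite mulr_signZ conj_opZ /conj_d !conj_opM sM dM sK addrC.
rewrite rmorphXn /= rmorphN1 !(sE _ _ hx) linearZ /=.
by rewrite -!scalerAr.
Qed.
Fact conj_0_inj : injective conj_0.
Proof. by move=> x y /dc_0_inj /(can_inj (star_inv hst)). Qed.
Fact conj_0_im x : gr 0 x <-> exists b, conj_0 b = x.
Proof.
rewrite /gr dc_0_im; split=> [] [b <-]; exists (st b) => //.
by rewrite /conj_0 (star_inv hst).
Qed.
Fact conj_1_inj : injective conj_1.
Proof. by case: hsg => _ sgK _ _ _ x y /dc_1_inj /(can_inj sgK). Qed.
Fact conj_1_im x : gr 1 x <-> exists w, conj_1 w = x.
Proof.
case: hsg => _ sgK _ _ _.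
rewrite /gr dc_1_im; split=> [] [b <-]; exists (sg b) => //.
by rewrite /conj_1 sgK.
Qed.
Fact conj_1_l b w : conj_1 (lact b w) = conj_0 b * conj_1 w.
Proof. by case: hsg => _ _ h _ _; rewrite /conj_1 h dc_1_r. Qed.
Fact conj_1_r w b : conj_1 (ract w b) = conj_1 w * conj_0 b.
Proof. by case: hsg => _ _ _ h _; rewrite /conj_1 h dc_1_l. Qed.
Fact conj_1_d b : conj_1 (fo_d G b) = conj_d (conj_0 b).
Proof.
case: hsg => _ _ _ _ h; rewrite /conj_1 h dc_1_d /conj_d /conj_0.
have [sE _ _ _ _] := hsigma; rewrite (sE 0) ?scale1r //.
by apply/dc_0_im; exists (st b).
Qed.
Fact conj_generated (S : conj_op W -> Prop) :
  (forall b, S (conj_0 b)) -> (forall b, S (conj_d (conj_0 b))) ->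
  (forall x y, S x -> S y -> S (x + y)) ->
  (forall x y, S x -> S y -> S (x * y)) -> forall x, S x.
Proof.
move=> h0 h1 hD hM; apply: dc_generated => [b|b|//|x y hx hy].
- by rewrite -(star_inv hst b); apply: h0.
- have [_ _ _ _ h] := hsg.
  by rewrite -dc_1_d -(star_inv hst b) -h -[dc_1 _ _]/(conj_1 _) conj_1_d.
- exact: (hM y x).
Qed.

Definition conj_dcalc : dcalc G := @DCalc R B G (conj_op W) gr
  conj_gr_linear conj_grM (@dc_gr_span _ _ _ W) (@dc_gr_direct _ _ _ W)
  conj_d conj_d_gr conj_dd conj_leibniz conj_0 conj_0_inj conj_0_im
  conj_1 conj_1_inj conj_1_im conj_1_l conj_1_r conj_1_d conj_generated.
End ConjCalculus.

(** The map from [W] to its conjugate given by universality is involutive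
    because its square fixes B and dB; rescaling degree k by (-1)^{k(k-1)/2}
    restores the sign (-1)^{kl} of the product and the usual differential. *)
Theorem universal_star (sg : G -> G) : fodc_star sg -> universal_dcalc W ->
  differential_star_calculus st W.
Proof.
move=> hsg hW.
have [sigma hsigma] := dc_parity.
have [f [fgr fd f0 f1 _]] := hW (conj_dcalc hsg hsigma).
pose e k : C := (-1) ^+ 'C(k, 2).
have [T hT] := degree_twist e.
pose F : W -> W := f.
have [[FD' FZ'] _ FM'] := lrmorphism_conj_op f.
have FD x y : F (x + y) = F x + F y by exact: FD'.
have FZ c x : F (c *: x) = c^* *: F x by exact: FZ'.
have FM x y : F (x * y) = F y * F x by exact: FM'.
have Fgr k x : dc_gr k x -> dc_gr k (F x) by exact: fgr.
have Fd x : F (dc_d W x) = dc_d W (sigma (F x)) by exact: fd.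
have F0 b : F (dc_0 W b) = dc_0 W (st b) by exact: f0.
have Fw w : F (dc_1 W w) = dc_1 W (sg w) by exact: f1.
have FF x : F (F x) = x.
  apply: (dc_generated (S := fun x => F (F x) = x)) => [b|b|x' y hx hy|x' y hx hy].
  - by rewrite !F0 (star_inv hst).
  - by have [_ sgK _ _ _] := hsg; rewrite -dc_1_d !Fw sgK.
  - by rewrite !FD hx hy.
  - by rewrite !FM hx hy.
have ee k : e k * e k = 1 by rewrite -expr2 sqrr_sign.
have eR k : (e k)^* = e k by rewrite rmorphXn /= rmorphN1.
exists (fun x => T (F x)); split.
- move=> b; rewrite F0 (hT 0) ?scale1r //.
  by apply/dc_0_im; exists (st b).
- split=> [x y|c x]; first by rewrite FD linearD.
  by rewrite FZ linearZ.
- elim/dc_hom_ind => [x y hx hy|k x hx].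
    by rewrite FD linearD FD linearD hx hy.
  rewrite (hT _ _ (Fgr _ _ hx)) FZ FF linearZ /= (hT _ _ hx) scalerA.
  by rewrite eR ee scale1r.
- elim/dc_hom_ind => [x y hx hy|k x hx].
    by rewrite !(linearD, FD) /= hx hy.
  have hFx := Fgr _ _ hx.
  rewrite (hT _ _ hFx) linearZ /= Fd (hT k.+1); last first.
    by rewrite -Fd; apply/Fgr/dc_d_gr.
  have [sE _ _ _ _] := hsigma; rewrite (sE _ _ hFx).
  rewrite linearZ /= scalerA.
  by rewrite /e binS bin1 exprD -mulrA -expr2 sqrr_sign mulr1.
- move=> k l x y hx hy.
  have hFx := Fgr _ _ hx; have hFy := Fgr _ _ hy.
  rewrite FM (hT _ _ hFx) (hT _ _ hFy) (hT _ _ (dc_grM hFy hFx)).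
  rewrite mulr_signZ -scalerAl -!scalerAr !scalerA.
  congr (_ *: _); rewrite /e bin2D !exprD mulnC.
  by rewrite mulrC mulrA.
Qed.
End Calculus.
End StarCalculus.

(** * Tensor products and antilinear flips *)

Section Tensors.
Variable R : realType.
Local Notation C := R[i].

Lemma linfun_linearE (U W : vectType C) (f : U -> W) : linear f -> linfun f =1 f.
Proof.
move=> hf x.
exact: (lfunE (HB.pack_for {linear U -> W} f (GRing.isLinear.Build C U W *:%R f hf))).
Qed.

Lemma tliftE (U W X : vectType C) (b : U -> W -> X) (m : tens U W) :
  tlift b m = \sum_i \sum_j (m : 'M_(_, _)) i j *:
                b (vbasis {:U})`_i (vbasis {:W})`_j.
Proof.
rewrite /tlift linfun_linearE // => c x y.
rewrite scaler_sumr -big_split; apply: eq_bigr => i _ /=.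
rewrite scaler_sumr -big_split; apply: eq_bigr => j _ /=.
by rewrite !mxE scalerDl scalerA.
Qed.

Definition bilinear_map (U W X : lmodType C) (b : U -> W -> X) :=
  (forall w, linear (b^~ w)) /\ (forall u, linear (b u)).

Lemma coord_vbasisE (U : vectType C) (u : U) :
  u = \sum_i coord (vbasis {:U}) i u *: (vbasis {:U})`_i.
Proof. by rewrite -coord_vbasis ?memvf. Qed.

Lemma coord_vbasis_free (U : vectType C) (i j : 'I_(\dim {:U})) :
  coord (vbasis {:U}) j (vbasis {:U})`_i = (i == j)%:R.
Proof. by apply: coord_free; apply: basis_free (vbasisP _). Qed.

Lemma linear_fun0 (U X : lmodType C) (f : U -> X) : linear f -> f 0 = 0.
Proof.
move=> hf; have := hf (-1) 0 0.
by rewrite scaleN1r oppr0 addr0 => ->; rewrite scaleN1r addNr.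
Qed.

Lemma linear_fun_sum (U X : lmodType C) (f : U -> X) (I : Type) (r : seq I)
    (c : I -> C) (u : I -> U) : linear f ->
  f (\sum_(i <- r) c i *: u i) = \sum_(i <- r) c i *: f (u i).
Proof.
move=> hf; elim: r => [|i r IH]; first by rewrite !big_nil linear_fun0.
by rewrite !big_cons hf IH.
Qed.

Lemma tlift_pure (U W X : vectType C) (b : U -> W -> X) u w : bilinear_map b ->
  tlift b (tpure u w) = b u w.
Proof.
move=> [hl hr]; rewrite tliftE [in RHS](coord_vbasisE u) (linear_fun_sum _ _ _ (hl w)).
apply: eq_bigr => i _; rewrite [in RHS](coord_vbasisE w) (linear_fun_sum _ _ _ (hr _)).
by rewrite scaler_sumr; apply: eq_bigr => j _; rewrite mxE scalerA.
Qed.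

Lemma tpure_bilinear (U W : vectType C) : bilinear_map (@tpure R U W).
Proof.
split=> [w c x y|u c x y]; apply/matrixP => i j; rewrite !mxE linearD linearZ /=.
  by rewrite mulrDl mulrA.
by rewrite mulrDr mulrCA.
Qed.

Lemma tpureDl (U W : vectType C) (u u' : U) (w : W) :
  tpure (u + u') w = tpure u w + tpure u' w.
Proof. by have := (tpure_bilinear U W).1 w 1 u u'; rewrite !scale1r. Qed.
Lemma tpureDr (U W : vectType C) (u : U) (w w' : W) :
  tpure u (w + w') = tpure u w + tpure u w'.
Proof. by have := (tpure_bilinear U W).2 u 1 w w'; rewrite !scale1r. Qed.
Lemma tpure0l (U W : vectType C) (w : W) : tpure (0 : U) w = 0.
Proof. exact: linear_fun0 ((tpure_bilinear U W).1 w). Qed.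
Lemma tpure0r (U W : vectType C) (u : U) : tpure u (0 : W) = 0.
Proof. exact: linear_fun0 ((tpure_bilinear U W).2 u). Qed.
Lemma tpureZl (U W : vectType C) c (u : U) (w : W) :
  tpure (c *: u) w = c *: tpure u w.
Proof. by have := (tpure_bilinear U W).1 w c u 0; rewrite tpure0l !addr0. Qed.
Lemma tpureZr (U W : vectType C) c (u : U) (w : W) :
  tpure u (c *: w) = c *: tpure u w.
Proof. by have := (tpure_bilinear U W).2 u c w 0; rewrite tpure0r !addr0. Qed.

Lemma tens_expand (U W : vectType C) (m : tens U W) :
  m = \sum_i \sum_j (m : 'M_(_, _)) i j *:
        tpure (vbasis {:U})`_i (vbasis {:W})`_j.
Proof.
apply/matrixP => k l; rewrite summxE (bigD1 k) //= summxE (bigD1 l) //= !mxE.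
rewrite !coord_vbasis_free !eqxx !mulr1.
rewrite [X in _ = _ + X]big1 ?addr0; last first.
  move=> i hi; rewrite summxE big1 // => j _; rewrite !mxE coord_vbasis_free.
  by rewrite (negPf hi) mul0r mulr0.
rewrite [X in _ = _ + X]big1 ?addr0 // => j hj.
by rewrite !mxE !coord_vbasis_free (negPf hj) !mulr0.
Qed.

Lemma tens_ind (U W : vectType C) (P : tens U W -> Prop) :
  (forall x y, P x -> P y -> P (x + y)) -> (forall u w, P (tpure u w)) ->
  forall m, P m.
Proof.
move=> hD hP m; have P0 : P 0 by rewrite -(tpure0l U (0 : W)).
rewrite (tens_expand m); apply: (big_ind P) => // i _.
by apply: (big_ind P) => // j _; rewrite -tpureZl.
Qed.

Lemma tmap_pure (U W U' W' : vectType C) (f : 'Hom(U, U')) (h : 'Hom(W, W')) u w :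
  tmap f h (tpure u w) = tpure (f u) (h w).
Proof.
apply: tlift_pure; split=> [{}w c x y|{}u c x y]; rewrite linearD linearZ /=.
  by rewrite tpureDl tpureZl.
by rewrite tpureDr tpureZr.
Qed.

Lemma tcoord_pure (U W : vectType C) (a b : nat) (bU : a.-tuple U)
    (bW : b.-tuple W) k l u w :
  tcoord bU bW k l (tpure u w) = coord bU k u * coord bW l w.
Proof.
apply: tlift_pure; split=> [{}w c x y|{}u c x y]; rewrite linearD linearZ /=.
  by rewrite mulrDl -mulrA.
by rewrite mulrDr mulrCA.
Qed.

Lemma tcoord_expand (U W : vectType C) (a b : nat) (bU : a.-tuple U)
    (bW : b.-tuple W) (x : tens U W) : basis_of fullv bU -> basis_of fullv bW ->
  x = \sum_k \sum_l tcoord bU bW k l x *: tpure (tnth bU k) (tnth bW l).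
Proof.
move=> hU hW; elim/tens_ind: x => [x y hx hy|u w].
  rewrite {1}hx {1}hy -big_split; apply: eq_bigr => k _ /=.
  by rewrite -big_split; apply: eq_bigr => l _ /=; rewrite linearD scalerDl.
have {1}-> : u = \sum_k coord bU k u *: tnth bU k.
  rewrite {1}(coord_basis hU (memvf u)).
  by apply: eq_bigr => k _; rewrite (tnth_nth 0).
have {1}-> : w = \sum_k coord bW k w *: tnth bW k.
  rewrite {1}(coord_basis hW (memvf w)).
  by apply: eq_bigr => k _; rewrite (tnth_nth 0).
rewrite (linear_fun_sum _ _ _ ((tpure_bilinear _ _).1 _)).
apply: eq_bigr => k _; rewrite (linear_fun_sum _ _ _ ((tpure_bilinear _ _).2 _)).
rewrite scaler_sumr; apply: eq_bigr => l _.
by rewrite scalerA tcoord_pure.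
Qed.

Lemma antilinear0 (U W : lmodType C) (f : U -> W) : antilinear f -> f 0 = 0.
Proof. by move=> [_ hZ]; rewrite -(scale0r 0) hZ rmorph0 !scale0r. Qed.

Lemma antilinear_sum (U W : lmodType C) (f : U -> W) (I : Type) (r : seq I)
    (c : I -> C) (u : I -> U) : antilinear f ->
  f (\sum_(i <- r) c i *: u i) = \sum_(i <- r) (c i)^* *: f (u i).
Proof.
move=> hf; elim: r => [|i r IH]; first by rewrite !big_nil antilinear0.
by rewrite !big_cons hf.1 hf.2 IH.
Qed.

Section Flip.
Variables (U W U' W' : vectType C) (J1 : U -> U') (J2 : W -> W').
Hypotheses (h1 : antilinear J1) (h2 : antilinear J2).

(** The antilinear map u (x) w |-> J2 w (x) J1 u. *)
Definition flip (m : tens U W) : tens W' U' :=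
  \sum_i \sum_j ((m : 'M_(_, _)) i j)^* *:
    tpure (J2 (vbasis {:W})`_j) (J1 (vbasis {:U})`_i).

Lemma flip_antilinear : antilinear flip.
Proof.
split=> [x y|c x].
  rewrite /flip -big_split; apply: eq_bigr => i _ /=.
  rewrite -big_split; apply: eq_bigr => j _ /=.
  by rewrite !mxE rmorphD scalerDl.
rewrite /flip scaler_sumr; apply: eq_bigr => i _ /=.
rewrite scaler_sumr; apply: eq_bigr => j _ /=.
by rewrite !mxE rmorphM scalerA.
Qed.

Lemma flip_pure u w : flip (tpure u w) = tpure (J2 w) (J1 u).
Proof.
rewrite /flip [in RHS](coord_vbasisE u) [in RHS](coord_vbasisE w).
rewrite (antilinear_sum _ _ _ h1) (antilinear_sum _ _ _ h2).
rewrite (linear_fun_sum _ _ _ ((tpure_bilinear _ _).2 _)); apply: eq_bigr => i _.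
rewrite (linear_fun_sum _ _ _ ((tpure_bilinear _ _).1 _)) scaler_sumr.
by apply: eq_bigr => j _; rewrite mxE rmorphM scalerA.
Qed.

End Flip.

Lemma components_flip (U W X Y U' W' X' Y' : vectType C)
  (J1 : U -> U') (J2 : W -> W') (J3 : X -> X') (J4 : Y -> Y')
  a b c d (bU : a.-tuple U) (bW : b.-tuple W) (bX : c.-tuple X) (bY : d.-tuple Y)
  (bU' : a.-tuple U') (bW' : b.-tuple W') (bX' : c.-tuple X') (bY' : d.-tuple Y')
  (T : 'Hom(tens U W, tens X Y)) (T' : 'Hom(tens W' U', tens Y' X')) :
  antilinear J1 -> antilinear J2 -> antilinear J3 -> antilinear J4 ->
  (forall i, J1 (tnth bU i) = tnth bU' i) -> (forall i, J2 (tnth bW i) = tnth bW' i) ->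
  (forall i, J3 (tnth bX i) = tnth bX' i) -> (forall i, J4 (tnth bY i) = tnth bY' i) ->
  basis_of fullv bX -> basis_of fullv bY -> basis_of fullv bX' -> basis_of fullv bY' ->
  (forall m, flip J3 J4 (T m) = T' (flip J1 J2 m)) ->
  forall k l i j, (components bU bW bX bY T k l i j)^*
    = components bW' bU' bY' bX' T' l k j i.
Proof.
move=> h1 h2 h3 h4 e1 e2 e3 e4 hX hY hX' hY' hT k l i j.
have hf := flip_antilinear J3 J4.
rewrite /components -e1 -e2 -flip_pure // -hT.
rewrite [T _ in RHS](tcoord_expand _ hX hY).
set m := T _; have ex (F : 'I_c -> tens X Y) : flip J3 J4 (\sum_i F i) = \sum_i flip J3 J4 (F i).
  exact: (big_morph _ hf.1 (antilinear0 hf)).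
rewrite ex linear_sum (bigD1 k) //= [X in _ + X]big1 ?addr0; last first.
  move=> k' hk'; rewrite (antilinear_sum _ _ _ hf) linear_sum big1 // => l' _.
  rewrite linearZ /= flip_pure // tcoord_pure e3 e4 !(tnth_nth 0).
  rewrite !coord_free ?(basis_free hX') ?(basis_free hY') //.
  by rewrite (negPf hk') mulr0 scaler0.
rewrite (antilinear_sum _ _ _ hf) linear_sum (bigD1 l) //= [X in _ + X]big1 ?addr0; last first.
  move=> l' hl'.
  rewrite linearZ /= flip_pure // tcoord_pure e3 e4 !(tnth_nth 0).
  rewrite !coord_free ?(basis_free hX') ?(basis_free hY') //.
  by rewrite (negPf hl') mul0r scaler0.
rewrite linearZ /= flip_pure // tcoord_pure e3 e4 !(tnth_nth 0).
rewrite !coord_free ?(basis_free hX') ?(basis_free hY') // !eqxx.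
by rewrite mulr1; symmetry; apply: mulr1.
Qed.
End Tensors.

(** * Modules over the quantized enveloping algebra *)

Section Form.
Variables (R : realType) (g : simpleLie R) (t : cartanData g).
Local Notation C := R[i].

Lemma killing_sym (x y : g) : killing x y = killing y x.
Proof.
rewrite /killing; set b := vbasis _.
have hb : basis_of fullv b := vbasisP _.
by rewrite !(passmx.mxof_comp _ _ hb) mxtrace_mulC.
Qed.

Lemma adN (x : g) : ad (- x) = - ad x.
Proof.
have lin z : linear (lie_br z) by move=> c u v; apply: lie_br_linearr.
apply/lfunP => y; rewrite opp_lfunE !linfun_linearE //.
have h : linear (fun z => lie_br z y) by move=> c u v; apply: lie_br_linearl.
by rewrite -scaleN1r -[-1 *: x]addr0 h (linear_fun0 h) addr0 scaleN1r.
Qed.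

Lemma killingNl (x y : g) : killing (- x) y = - killing x y.
Proof.
rewrite /killing adN comp_lfunNl; set b := vbasis _; set f := (ad x \o ad y)%VF.
have hl := passmx.mxof_linear b b.
by rewrite -scaleN1r -[-1 *: f]addr0 hl (linear_fun0 hl) addr0 scaleN1r linearN.
Qed.

Lemma hform_sym (mu nu : hdual (cartan t)) : hform mu nu = hform nu mu.
Proof. exact: killing_sym. Qed.
Lemma hformNl (mu nu : hdual (cartan t)) : hform (- mu) nu = - hform mu nu.
Proof. by rewrite /hform !linearN; apply: killingNl. Qed.
Lemma hformNr (mu nu : hdual (cartan t)) : hform mu (- nu) = - hform mu nu.
Proof. by rewrite hform_sym hformNl hform_sym. Qed.
End Form.

Section QPow.
Variables (R : realType) (q : R) (hq : 0 < q < 1).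
Local Notation C := R[i].

Lemma qpow_conj z : (qpow q z)^* = qpow q z.
Proof. exact: conjc_real. Qed.
Lemma qpow_neq0 z : qpow q z != 0.
Proof.
have /andP[q0 _] := hq.
by rewrite /qpow fmorph_eq0 gt_eqF // powR_gt0.
Qed.
Lemma qpowN z : qpow q (- z) = (qpow q z)^-1.
Proof.
rewrite /qpow; case: z => a b /=.
by rewrite powRN fmorphV.
Qed.
Lemma qpowVK z : qpow q (- z) * qpow q z = 1.
Proof. by rewrite qpowN mulVf // qpow_neq0. Qed.
Lemma qpowKV z : qpow q z * qpow q (- z) = 1.
Proof. by rewrite mulrC qpowVK. Qed.
End QPow.

Section VspacePred.
Variables (R : realType).
Local Notation C := R[i].

Definition linear_pred (U : lmodType C) (P : U -> Prop) :=
  P 0 /\ forall c x y, P x -> P y -> P (c *: x + y).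

Lemma linear_predZ (U : lmodType C) (P : U -> Prop) c x :
  linear_pred P -> P x -> P (c *: x).
Proof. by move=> [P0 Plin] hx; rewrite -[_ *: x]addr0; apply: Plin. Qed.

(** A subspace of maximal dimension among those contained in [P]. *)
Lemma linear_pred_vspace (U : vectType C) (P : U -> Prop) : linear_pred P ->
  exists S : {vspace U}, forall x, x \in S <-> P x.
Proof.
move=> hP; have [P0 Plin] := hP.
pose Q n := `[< exists S : {vspace U}, (forall x, x \in S -> P x) /\ \dim S = n >].
have exQ : exists n, Q n.
  by exists 0%N; apply/asboolP; exists 0%VS; rewrite dimv0; split=> // x; rewrite memv0 => /eqP ->.
have ubQ n : Q n -> (n <= \dim {:U})%N.
  by move/asboolP => [S [_ <-]]; apply/dimvS/subvf.
case: (ex_maxnP exQ ubQ) => n /asboolP [S [hS dS]] hmax.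
exists S => x; split; first exact: hS.
move=> Px; have sub : (S <= S + <[x]>)%VS by apply: addvSl.
suff : \dim (S + <[x]>) = \dim S.
  move=> e; have /eqP -> : S == (S + <[x]>)%VS by rewrite eqEdim sub e leqnn.
  by apply: subvP (addvSr _ _) _ _; rewrite memv_line.
apply/eqP; rewrite eqn_leq (dimvS sub) andbT dS; apply: hmax; apply/asboolP.
exists (S + <[x]>)%VS; split=> // y /memv_addP[u hu [v /vlineP[k ->] ->]].
by rewrite addrC; apply: Plin => //; apply: hS.
Qed.
End VspacePred.

Section Modules.
Variables (R : realType) (g : simpleLie R) (t : cartanData g) (q : R).
Hypothesis hq : 0 < q < 1.
Local Notation C := R[i].
Local Notation preModule := (preModule t).
Local Notation qpow := (qpow q).
Local Notation I := 'I_(rank t).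
Local Notation "( x , y )f" := (hform x y) (at level 0, format "( x , y )f").

Lemma simple_ind (M : preModule) (P : M -> Prop) : simple_module q M ->
  linear_pred P ->
  (forall i x, P x -> [/\ P (opK M i x), P (opK' M i x), P (opE M i x)
                        & P (opF M i x)]) ->
  (exists2 x, P x & x != 0) -> forall x, P x.
Proof.
move=> [_ _ hsimple] /linear_pred_vspace[S hS] hop [x0 hx0 nx0] x; apply/hS.
have [i u|h0|->] := hsimple S; last exact: memvf.
  move/hS => hu; have [h1 h2 h3 h4] := hop i u hu.
  by split; apply/hS.
by move/hS: hx0; rewrite h0 memv0 (negPf nx0).
Qed.

Section ModuleFacts.
Variables (M : preModule) (hM : Uq_relations q M).

Lemma KK'E i x : opK M i (opK' M i x) = x.
Proof. by have := Uq_KK' hM i => /lfunP/(_ x); rewrite comp_lfunE id_lfunE. Qed.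
Lemma K'KE i x : opK' M i (opK M i x) = x.
Proof. by have := Uq_K'K hM i => /lfunP/(_ x); rewrite comp_lfunE id_lfunE. Qed.
Lemma KEE i j x : opK M i (opE M j x) = qpow (alpha i, alpha j)f *: opE M j (opK M i x).
Proof.
have := Uq_KE hM i j => /lfunP/(_ (opK M i x)).
by rewrite !comp_lfunE K'KE scale_lfunE.
Qed.
Lemma KFE i j x : opK M i (opF M j x) = qpow (- (alpha i, alpha j)f) *: opF M j (opK M i x).
Proof.
have := Uq_KF hM i j => /lfunP/(_ (opK M i x)).
by rewrite !comp_lfunE K'KE scale_lfunE.
Qed.
Lemma EFE i j x : opE M i (opF M j x) = opF M j (opE M i x)
  + ((i == j)%:R / (q_ q i - (q_ q i)^-1)) *: (opK M i x - opK' M i x).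
Proof.
have := Uq_EF hM i j => /lfunP/(_ x).
rewrite !(scale_lfunE, add_lfunE, opp_lfunE, comp_lfunE) => <-.
by rewrite addrC subrK.
Qed.

Definition K_eigen (u : M) : Prop := forall i, exists a, opK M i u = a *: u.

Lemma K'_eigen u : K_eigen u -> forall i, exists a, opK' M i u = a *: u.
Proof.
move=> hu i; have [a ha] := hu i.
have e : u = a *: opK' M i u by rewrite -linearZ -ha /= K'KE.
have [a0|na] := eqVneq a 0.
  by exists 0; rewrite e a0 scale0r linear0 scaler0.
by exists a^-1; rewrite [in RHS]e scalerA mulVf // scale1r.
Qed.
End ModuleFacts.

Inductive op_span (M : preModule) (X : I -> 'End(M)) (u : M) : M -> Prop :=
| op_span0 : op_span X u 0
| op_span_u : op_span X u u
| op_span_lin c x y : op_span X u x -> op_span X u y -> op_span X u (c *: x + y)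
| op_span_op i x : op_span X u x -> op_span X u (X i x).

Lemma op_span_linear (M : preModule) X (u : M) : linear_pred (op_span X u).
Proof. by split; [exact: op_span0|move=> *; apply: op_span_lin]. Qed.

(** The easy half of the triangular decomposition: moving Y and K past the X's
    produces only words in the X's.  It is used for (X, Y) = (F, E) and (E, F). *)
Lemma op_span_closed (M : preModule) (X Y : I -> 'End(M)) (u : M) :
  Uq_relations q M -> K_eigen u -> (forall i, Y i u = 0) ->
  (forall i j, exists2 a, a != 0 & forall x, opK M i (X j x) = a *: X j (opK M i x)) ->
  (forall i j, exists c, forall x,
     Y i (X j x) = X j (Y i x) + c *: (opK M i x - opK' M i x)) ->
  forall i x, op_span X u x ->
    [/\ op_span X u (opK M i x), op_span X u (opK' M i x)
      & op_span X u (Y i x)].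
Proof.
move=> hM hu hY hKX hYX i; have hl := op_span_linear X u.
have hK x : op_span X u x -> op_span X u (opK M i x).
  elim=> [||c y z _ hy _ hz|j y _ hy].
  - by rewrite linear0; constructor.
  - by have [a ->] := hu i; apply: linear_predZ => //; constructor.
  - by rewrite linearD linearZ; constructor.
  - by have [a _ ->] := hKX i j; apply: linear_predZ => //; constructor.
have hK' x : op_span X u x -> op_span X u (opK' M i x).
  elim=> [||c y z _ hy _ hz|j y _ hy].
  - by rewrite linear0; constructor.
  - by have [a ->] := K'_eigen hM hu i; apply: linear_predZ => //; constructor.
  - by rewrite linearD linearZ; constructor.
  - have [a na e] := hKX i j.
    have -> : opK' M i (X j y) = a^-1 *: X j (opK' M i y).
      apply: (can_inj (K'KE hM i)); rewrite (KK'E hM) linearZ /= e (KK'E hM).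
      by rewrite scalerA mulVf // scale1r.
    by apply: linear_predZ => //; constructor.
move=> x hx; split; [exact: hK|exact: hK'|].
elim: hx => [||c y z _ hy _ hz|j y hy hYy].
- by rewrite linear0; constructor.
- by rewrite hY; constructor.
- by rewrite linearD linearZ; constructor.
- have [c ->] := hYX i j; rewrite addrC; apply: op_span_lin; last by constructor.
  rewrite -scaleN1r addrC; apply: op_span_lin; [exact: hK'|exact: hK].
Qed.

Lemma weight_eigen (M : preModule) mu (u : M) : weight_vector q mu u -> K_eigen u.
Proof. by move=> h i; exists (qpow (alpha i, mu)f). Qed.

Lemma highest_generates (M : preModule) mu (u : M) : simple_module q M ->
  highest_weight_vector q mu u -> forall x, op_span (opF M) u x.
Proof.
move=> hs [nu hwt hE]; have [[hM _] _ _] := hs.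
have hcl := op_span_closed (X := opF M) (Y := opE M) hM (weight_eigen hwt) hE.
apply: (simple_ind hs (op_span_linear _ _)) => [i x hx|]; last first.
  by exists u => //; constructor.
have [|//|h1 h2 h3] := hcl _ _ i x hx.
- move=> k j; exists (qpow (- (alpha k, alpha j)f)); first exact: qpow_neq0.
  exact: (KFE hM).
- by move=> k j; eexists; apply: (EFE hM).
by split=> //; constructor.
Qed.

Lemma lowest_generates (M : preModule) mu (u : M) : simple_module q M ->
  lowest_weight_vector q mu u -> forall x, op_span (opE M) u x.
Proof.
move=> hs [nu hwt hF]; have [[hM _] _ _] := hs.
have hcl := op_span_closed (X := opE M) (Y := opF M) hM (weight_eigen hwt) hF.
apply: (simple_ind hs (op_span_linear _ _)) => [i x hx|]; last first.
  by exists u => //; constructor.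
have [|//|h1 h2 h3] := hcl _ _ i x hx.
- move=> k j; exists (qpow (alpha k, alpha j)f); first exact: qpow_neq0.
  exact: (KEE hM).
- move=> k j; exists (- ((j == k)%:R / (q_ q j - (q_ q j)^-1))) => y.
  rewrite (EFE hM) scaleNr; have [->|_] := eqVneq j k; first by rewrite addrK.
  by rewrite !mul0r !scale0r !addr0 oppr0 addr0.
by split=> //; constructor.
Qed.

(** [J] is antilinear and intertwines X with tau(X), where tau(X) = S^{-1}(X^* )
    is the involutive antilinear automorphism of U_q(g) with
    tau(K) = K^-1, tau(E) = - q^(a,a) F and tau(F) = - q^-(a,a) E. *)
Record twist (M M' : preModule) (J : M -> M') : Prop := {
  twist_antilinear : antilinear J;
  twistK : forall i x, J (opK M i x) = opK' M' i (J x);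
  twistK' : forall i x, J (opK' M i x) = opK M' i (J x);
  twistE : forall i x, J (opE M i x) = - qpow (alpha i, alpha i)f *: opF M' i (J x);
  twistF : forall i x, J (opF M i x) = - qpow (- (alpha i, alpha i)f) *: opE M' i (J x) }.

Lemma twist_inv (M M' : preModule) (J : M -> M') (J' : M' -> M) :
  cancel J J' -> cancel J' J -> twist J -> twist J'.
Proof.
move=> JK J'K hJ; have [[JD JZ] JKK JKK' JE JF] := hJ.
split=> [|i x|i x|i x|i x]; try apply: (can_inj JK).
- split=> [x y|c x]; apply: (can_inj JK); first by rewrite JD !J'K.
  by rewrite JZ conjCK !J'K.
- by rewrite JKK' !J'K.
- by rewrite JKK !J'K.
- rewrite JZ JF !J'K rmorphN /= qpow_conj scalerA mulrNN.
  by rewrite (qpowKV hq) scale1r.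
- rewrite JZ JE !J'K rmorphN /= qpow_conj scalerA mulrNN.
  by rewrite (qpowVK hq) scale1r.
Qed.

Lemma lfun_powS (U : vectType C) (X : 'End(U)) k x :
  lfun_pow X k.+1 x = X (lfun_pow X k x).
Proof. by rewrite /lfun_pow iterS comp_lfunE. Qed.

(** The q-binomials are real and the Serre sum is homogeneous, so conjugation and
    rescaling of the generators do not matter. *)
Lemma serre_transport (M M' : preModule) (J : M -> M') (J' : M' -> M)
    (X : I -> 'End(M)) (Y : I -> 'End(M')) (a : I -> C) :
  antilinear J -> cancel J' J -> (forall i x, Y i (J x) = a i *: J (X i x)) ->
  serre q X -> serre q Y.
Proof.
move=> hJ J'K hXY hX i j m hij hm; apply/lfunP => y; rewrite zero_lfunE.
rewrite -[y]J'K; set x := J' y.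
have powE k z l : lfun_pow (Y l) k (J z) = a l ^+ k *: J (lfun_pow (X l) k z).
  elim: k => [|k IH]; first by rewrite /lfun_pow /= !id_lfunE scale1r.
  by rewrite !lfun_powS IH linearZ /= hXY scalerA exprSr.
have := congr1 (fun f : 'End(M) => J (f x)) (hX i j m hij hm).
rewrite zero_lfunE (antilinear0 hJ) => e.
apply: etrans (etrans (congr1 ( *:%R (a i ^+ m * a j)) e) (scaler0 _ _)).
rewrite !sum_lfunE (big_morph J hJ.1 (antilinear0 hJ)) scaler_sumr.
apply: eq_bigr => k _; rewrite !scale_lfunE !comp_lfunE hJ.2 powE.
rewrite linearZ /= hXY !linearZ /= powE !scalerA; congr (_ *: _).
have -> : ((-1) ^+ k * qbin (q_ q i) m k)^* = (-1) ^+ k * qbin (q_ q i) m k.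
  have qr n : (qnum (q_ q i) n)^* = qnum (q_ q i) n.
    by rewrite /qnum fmorph_div !rmorphB !fmorphV !rmorphXn /= qpow_conj.
  have qf n : (qfact (q_ q i) n)^* = qfact (q_ q i) n.
    by rewrite /qfact rmorph_prod; apply: eq_bigr => l _; apply: qr.
  by rewrite rmorphM rmorphXn /= rmorphN1 /qbin fmorph_div rmorphM /= !qf.
have -> : a i ^+ m = a i ^+ (m - k) * a i ^+ k.
  by rewrite -exprD subnK // -ltnS ltn_ord.
by ring.
Qed.

Lemma integral_weightN (mu : hdual (cartan t)) :
  integral_weight mu -> integral_weight (- mu).
Proof.
move=> [c ->]; exists (fun i => - c i).
by rewrite -sumrN; apply: eq_bigr => i _; rewrite mulrNz.
Qed.

Lemma twist_weight (M M' : preModule) (J : M -> M') mu u : twist J ->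
  Uq_relations q M -> weight_vector q mu u ->
  weight_vector q (- mu) (J u).
Proof.
move=> hJ hM hu i; have [[JD JZ] JKK JKK' JE JF] := hJ.
rewrite hformNr qpowN; apply: (canRL (scalerK (qpow_neq0 hq _))).
by rewrite -JKK' -[X in X *: J _]qpow_conj -JZ -linearZ /= -hu (K'KE hM).
Qed.

Lemma twist_Uq (M M' : preModule) (J : M -> M') (J' : M' -> M) :
  cancel J J' -> cancel J' J -> twist J -> Uq_module q M -> Uq_module q M'.
Proof.
move=> JK J'K hJ [hM hT]; have [[JD JZ] JKK JKK' JE JF] := hJ.
have J0 := antilinear0 (conj JD JZ).
have JN x : J (- x) = - J x by rewrite -scaleN1r JZ rmorphN1 scaleN1r.
have hF i x : opF M' i (J x) = - qpow (- (alpha i, alpha i)f) *: J (opE M i x).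
  by rewrite JE scalerA mulrNN (qpowVK hq) scale1r.
have hE i x : opE M' i (J x) = - qpow (alpha i, alpha i)f *: J (opF M i x).
  by rewrite JF scalerA mulrNN (qpowKV hq) scale1r.
split; last first.
  move=> y; have [m [mu [w [hw e]]]] := hT (J' y).
  exists m, (fun k => - mu k), (fun k => J (w k)); split; last first.
    by rewrite -(big_morph J JD J0) -e J'K.
  move=> k; have [hc hk] := hw k; split; first exact: integral_weightN.
  exact: (twist_weight hJ hM).
have KK i j x : opK M i (opK M j x) = opK M j (opK M i x).
  by have := Uq_KK hM i j => /lfunP/(_ x); rewrite !comp_lfunE.
split.
- move=> i; apply/lfunP => y; rewrite -[y]J'K.
  by rewrite comp_lfunE id_lfunE -JKK -JKK' (K'KE hM).
- move=> i; apply/lfunP => y; rewrite -[y]J'K.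
  by rewrite comp_lfunE id_lfunE -JKK' -JKK (KK'E hM).
- move=> i j; apply/lfunP => y; rewrite -[y]J'K !comp_lfunE -!JKK'.
  congr J; set x := J' y; rewrite -{2}(KK'E hM j x) -{2}(KK'E hM i (opK' M j x)).
  by rewrite KK !(K'KE hM).
- move=> i j; apply/lfunP => y; rewrite -[y]J'K scale_lfunE !comp_lfunE.
  rewrite -JKK hE linearZ /= -JKK' hE.
  have -> : opF M j (opK M i (J' y)) = qpow (alpha i, alpha j)f *: opK M i (opF M j (J' y)).
    by rewrite (KFE hM) scalerA (qpowKV hq) scale1r.
  by rewrite linearZ /= (K'KE hM) JZ qpow_conj !scalerA mulrC.
- move=> i j; apply/lfunP => y; rewrite -[y]J'K scale_lfunE !comp_lfunE.
  rewrite -JKK hF linearZ /= -JKK' hF.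
  have -> : opE M j (opK M i (J' y)) = qpow (- (alpha i, alpha j)f) *: opK M i (opE M j (J' y)).
    by rewrite (KEE hM) scalerA (qpowVK hq) scale1r.
  by rewrite linearZ /= (K'KE hM) JZ qpow_conj !scalerA mulrC.
- move=> i j; apply/lfunP => y; rewrite -[y]J'K; set x := J' y.
  rewrite !(scale_lfunE, add_lfunE, opp_lfunE, comp_lfunE) -JKK -JKK'.
  rewrite hF hE !linearZ /= hE hF !scalerA.
  have [<-|nij] := eqVneq i j; last first.
    have := EFE hM j i x; rewrite eq_sym (negPf nij) !mul0r !scale0r addr0 => ->.
    by rewrite scalerN scalerA mulrC subrr.
  rewrite scalerN scalerA !mulrNN (qpowVK hq) (qpowKV hq) !scale1r.
  have := EFE hM i i x; rewrite eqxx => ->.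
  rewrite JD JZ !JD !JN opprD addrA subrr add0r -scalerN opprB.
  congr (_ *: _).
  by rewrite fmorph_div rmorphB fmorphV /= rmorph_nat /q_ qpow_conj.
- apply: (serre_transport (J' := J') (conj JD JZ) J'K hE); exact: Uq_serreF hM.
- apply: (serre_transport (J' := J') (conj JD JZ) J'K hF); exact: Uq_serreE hM.
Qed.

Section TwistTransport.
Variables (M M' : preModule) (J : M -> M') (J' : M' -> M).
Hypotheses (JK : cancel J J') (J'K : cancel J' J) (hJ : twist J).
Let hJ' : twist J' := twist_inv JK J'K hJ.

Lemma twist_neq0 u : u != 0 -> J u != 0.
Proof.
apply: contraNneq => e; apply/eqP/(can_inj JK).
by rewrite e (antilinear0 (twist_antilinear hJ)).
Qed.

Lemma twist_simple : simple_module q M -> simple_module q M'.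
Proof.
move=> hs; have [hM [u nu] _] := hs; split.
- exact: (twist_Uq JK J'K hJ).
- by exists (J u); apply: twist_neq0.
move=> N hN; have [/eqP N0|/eqP N0] := boolP (N == 0%VS); first by left.
right.
have [y hy ny] : exists2 y, y \in N & y != 0.
  by exists (vpick N); [exact: memv_pick|rewrite vpick0; apply/eqP].
apply/vspaceP => z; rewrite memvf -[z]J'K.
apply: (simple_ind (P := fun x => J x \in N) hs) => [|i x hx|].
- have [[JD JZ] _ _ _ _] := hJ.
  split; first by rewrite (antilinear0 (conj JD JZ)) mem0v.
  by move=> c x x' hx hx'; rewrite JD JZ memvD ?memvZ.
- have [h1 h2 h3 h4] := hN i _ hx; have [_ e1 e2 e3 e4] := hJ.
  by rewrite e1 e2 e3 e4; split=> //; apply: memvZ.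
- exists (J' y); first by rewrite J'K.
  by apply: contraNneq ny => e; rewrite -[y]J'K e (antilinear0 (twist_antilinear hJ)).
Qed.

Lemma twist_highest mu u : Uq_relations q M -> highest_weight_vector q mu u ->
  lowest_weight_vector q (- mu) (J u).
Proof.
move=> hM [nu hw hE]; split; [exact: twist_neq0|exact: (twist_weight hJ hM)|move=> i].
apply: (can_inj J'K); have [_ _ _ _ ->] := hJ'.
by rewrite JK hE scaler0 (antilinear0 (twist_antilinear hJ')).
Qed.

Lemma twist_lowest mu u : Uq_relations q M -> lowest_weight_vector q mu u ->
  highest_weight_vector q (- mu) (J u).
Proof.
move=> hM [nu hw hF]; split; [exact: twist_neq0|exact: (twist_weight hJ hM)|move=> i].
apply: (can_inj J'K); have [_ _ _ -> _] := hJ'.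
by rewrite JK hF scaler0 (antilinear0 (twist_antilinear hJ')).
Qed.

End TwistTransport.

(** tau reverses the coproduct, which is why the tensor factors are exchanged. *)
Lemma flip_twist (M N M' N' : preModule) (J1 : M -> M') (J2 : N -> N') :
  twist J1 -> twist J2 ->
  twist (flip J1 J2 : ptens M N -> ptens N' M').
Proof.
move=> h1 h2; have [a1 K1 K1' E1 F1] := h1; have [a2 K2 K2' E2 F2] := h2.
have [fD fZ] := flip_antilinear J1 J2.
split; first exact: flip_antilinear.
- move=> i; elim/tens_ind => [x y hx hy|u w].
    by rewrite linearD !fD hx hy linearD.
  by rewrite /= !tmap_pure !flip_pure // !tmap_pure K1 K2.
- move=> i; elim/tens_ind => [x y hx hy|u w].
    by rewrite linearD !fD hx hy linearD.
  by rewrite /= !tmap_pure !flip_pure // !tmap_pure K1' K2'.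
- move=> i; elim/tens_ind => [x y hx hy|u w].
    by rewrite linearD !fD hx hy linearD scalerDr.
  rewrite /= !add_lfunE fD !tmap_pure !flip_pure // !tmap_pure !id_lfunE.
  by rewrite E1 E2 K2 tpureZl tpureZr scalerDr addrC.
- move=> i; elim/tens_ind => [x y hx hy|u w].
    by rewrite linearD !fD hx hy linearD scalerDr.
  rewrite /= !add_lfunE fD !tmap_pure !flip_pure // !tmap_pure !id_lfunE.
  by rewrite F1 F2 K1' tpureZl tpureZr scalerDr addrC.
Qed.

(** Since E u = 0, applying E to u (x) y gives u (x) E y, so the E_i produce
    u (x) N out of u (x) w.  The F_i then enlarge the first factor, because
    F (x (x) y) is F x (x) y up to the term K^-1 x (x) F y, which is
    K^-1 (x (x) K F y). *)
Lemma tensor_cyclic (M N : preModule) mu nu (u : M) (w : N)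
    (P : ptens M N -> Prop) :
  simple_module q M -> simple_module q N ->
  highest_weight_vector q mu u -> lowest_weight_vector q nu w ->
  linear_pred P ->
  (forall i x, P x -> [/\ P (opK' (ptens M N) i x), P (opE (ptens M N) i x)
     & P (opF (ptens M N) i x)]) ->
  P (tpure u w) -> forall x, P x.
Proof.
move=> hM hN hu hw hP hop h0.
have hMr : Uq_relations q M by case: hM => [[]].
have hNr : Uq_relations q N by case: hN => [[]].
have hu' := hu; have [_ uwt uE] := hu.
have PB x y : P x -> P (x + y) -> P y.
  move=> hx hxy; have -> : y = -1 *: x + (x + y) by rewrite scaleN1r addKr.
  exact: hP.2.
have P1 y : P (tpure u y).
  elim: (lowest_generates hN hw y) => [||c y1 y2 _ h1 _ h2|i y1 _ h1].
  - by rewrite tpure0r; apply: hP.1.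
  - exact: h0.
  - by rewrite tpureDr tpureZr; apply: hP.2.
  - have [_ hE _] := hop i _ h1.
    by move: hE; rewrite /= add_lfunE !tmap_pure id_lfunE uE tpure0l add0r.
have P2 x : op_span (opF M) u x -> forall y, P (tpure x y).
  elim=> [||c x1 x2 _ h1 _ h2|i x1 _ h1] y.
  - by rewrite tpure0l; apply: hP.1.
  - exact: P1.
  - by rewrite tpureDl tpureZl; apply: hP.2.
  have [_ _ hF] := hop i _ (h1 y).
  have [hK _ _] := hop i _ (h1 (opK N i (opF N i y))).
  move: hF hK; rewrite /= add_lfunE !tmap_pure id_lfunE (K'KE hNr) addrC => hF hK.
  exact: PB hK hF.
elim/tens_ind => [x y hx hy|x y]; first by rewrite -[x]scale1r; apply: hP.2.
exact: P2 (highest_generates hM hu' x) y.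
Qed.

(** Both sides commute with the action, by [flip_twist], and the normalization of
    the braiding makes them agree on the generator u (x) w: under the flip it
    becomes J2 w (x) J1 u, again of the form highest (x) lowest, and
    (- nu, - mu) = (mu, nu). *)
Lemma braiding_flip (br : forall M N : preModule, 'Hom(ptens M N, ptens N M))
    (M N M' N' : preModule) (J1 : M -> M') (J2 : N -> N') mu nu (u : M) (w : N) :
  is_braiding q br ->
  simple_module q M -> simple_module q N ->
  simple_module q M' -> simple_module q N' ->
  twist J1 -> twist J2 ->
  integral_weight mu -> integral_weight nu ->
  highest_weight_vector q mu u -> lowest_weight_vector q nu w ->
  lowest_weight_vector q (- mu) (J1 u) -> highest_weight_vector q (- nu) (J2 w) ->
  forall x, flip J2 J1 (br M N x) = br N' M' (flip J1 J2 x).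
Proof.
move=> hbr hM hN hM' hN' h1 h2 imu inu hu hw hu' hw'.
have [uM _ _] := hM; have [uN _ _] := hN.
have [uM' _ _] := hM'; have [uN' _ _] := hN'.
have [mK mK' mE mF] := br_map hbr uM uN.
have [mK2 mK2' mE2 mF2] := br_map hbr uN' uM'.
have [[fD fZ] fK fK' fE fF] := flip_twist h1 h2.
have [[gD gZ] gK gK' gE gF] := flip_twist h2 h1.
apply: (tensor_cyclic hM hN hu hw).
- split=> [|c x y hx hy].
    by rewrite linear0 (antilinear0 (conj gD gZ)) (antilinear0 (conj fD fZ)) linear0.
  by rewrite linearD linearZ fD fZ gD gZ linearD linearZ hx hy.
- move=> i x hx; split.
  + by rewrite mK' fK' gK' mK2 hx.
  + by rewrite mE fE gE linearZ /= mF2 hx.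
  + by rewrite mF fF gF linearZ /= mE2 hx.
- have [a1 _ _ _ _] := h1; have [a2 _ _ _ _] := h2.
  rewrite (br_norm hbr hM hN imu inu hu hw) gZ !flip_pure // qpow_conj.
  rewrite (br_norm hbr hN' hM' _ _ hw' hu'); try exact: integral_weightN.
  by rewrite hformNl hformNr opprK hform_sym.
Qed.
End Modules.

(** * The fundamental module and its dual *)

Section Fundamental.
Variables (R : realType) (g : simpleLie R) (t : cartanData g) (q : R).
Hypothesis hq : 0 < q < 1.
Local Notation C := R[i].
Local Notation preModule := (preModule t).
Local Notation qpow := (qpow q).
Local Notation I := 'I_(rank t).
Local Notation "( x , y )f" := (hform x y) (at level 0, format "( x , y )f").
Local Notation twist := (twist q).
Variables (s : I) (V : fundModule q s).
Local Notation ip := (hk_ip (f:=V)).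

Let hV : simple_module q V := hk_simple V.
Let hVr : Uq_relations q V.
Proof. by case: hV => [[]]. Qed.

Lemma ip_linear u : linear (ip u).
Proof. by move=> c x y; apply: hk_ip_linear. Qed.
Lemma ip0 u : ip u 0 = 0.
Proof. exact: linear_fun0 (ip_linear u). Qed.
Lemma ipZ u c x : ip u (c *: x) = c * ip u x.
Proof. by rewrite -[_ *: x]addr0 ip_linear ip0 addr0. Qed.
Lemma ipD u x y : ip u (x + y) = ip u x + ip u y.
Proof. by rewrite -[x]scale1r ip_linear !scale1r. Qed.
Lemma ip_antilinear x : antilinear (ip^~ x : V -> C^o).
Proof.
have E y : ip y x = (ip x y)^* by exact: hk_ip_herm.
by split=> [u v|c u]; rewrite !E ?ipD ?ipZ ?rmorphD ?rmorphM.
Qed.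

Let u : V := tnth (hk_v V) ord_max.

Inductive word_vector : nat -> V -> Prop :=
| word_vector0 : word_vector 0 u
| word_vectorS n i x : word_vector n x -> word_vector n.+1 (opF V i x).

Inductive word_span (n : nat) : V -> Prop :=
| word_span0 : word_span n 0
| word_span_vector x : word_vector n x -> word_span n x
| word_span_lin c x y : word_span n x -> word_span n y -> word_span n (c *: x + y).

Lemma word_span_linear n : linear_pred (word_span n).
Proof. by split; [exact: word_span0|exact: word_span_lin]. Qed.

Lemma word_spanF n i x : word_span n x -> word_span n.+1 (opF V i x).
Proof.
elim=> [|y hy|c y z _ hy _ hz]; first by rewrite linear0; constructor.
  by apply/word_span_vector/word_vectorS.
by rewrite linearD linearZ; apply: word_span_lin.
Qed.

Lemma word_vector_eigen n x : word_vector n x -> K_eigen x.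
Proof.
elim=> [|{}n i {}x _ IH] j.
  by have [_ /weight_eigen h _] := hk_highest V; apply: h.
by have [a ha] := IH j; rewrite (KFE hVr) ha linearZ /= scalerA; eexists.
Qed.

Lemma word_span_K n i x : word_span n x -> word_span n (opK V i x) /\ word_span n (opK' V i x).
Proof.
elim=> [|y hy|c y z _ [h1 h2] _ [h3 h4]].
- by rewrite !linear0; split; constructor.
- have [a ->] := word_vector_eigen hy i.
  have [b ->] := K'_eigen hVr (word_vector_eigen hy) i.
  by split; apply: linear_predZ (word_span_linear n) _; apply: word_span_vector.
- by rewrite !linearD !linearZ; split; apply: word_span_lin.
Qed.

Lemma word_spanE n x : word_span n x -> forall i,
  if n is m.+1 then word_span m (opE V i x) else opE V i x = 0.
Proof.
elim=> [|y hy|c y z _ hy _ hz] i.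
- by rewrite linear0; case: n => // n; constructor.
- elim: hy i => [|m j {}y hy IH] i; first by have [_ _] := hk_highest V.
  rewrite (EFE hVr) addrC; apply: (word_span_linear m).2; last first.
    case: m IH {hy} => [|m] IH; last by apply/word_spanF/IH.
    by rewrite IH linear0; constructor.
  rewrite -scaleN1r addrC; have [] := word_span_K i (word_span_vector hy).
  by move=> *; apply: (word_span_linear m).2.
- rewrite linearD linearZ; move: (hy i) (hz i); case: (n) => [|m] /=.
    by move=> -> ->; rewrite scaler0 addr0.
  exact: word_span_lin.
Qed.

(** F_i is adjoint to K_i^-1 E_i, which lowers the word length of [y] while F_i is
    removed from [x]; the shorter word dies first since E_i kills the highest
    weight vector. *)
Lemma word_span_orthogonal m x n y : word_span m x -> word_span n y -> (n < m)%N ->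
  ip x y = 0.
Proof.
move=> hx; elim: hx n y => [|{}x hx|c x1 x2 _ h1 _ h2] n y hy hnm.
- exact: (antilinear0 (ip_antilinear y)).
- elim: hx n y hy hnm => [//|{}m i {}x _ IH] n y hy hnm.
  rewrite hk_ipF; have := word_spanE hy i; case: n hy hnm => [|n] hy hnm.
    by move=> ->; rewrite linear0 ip0.
  by move=> /(word_span_K i)[_ /IH]; apply.
- have [hD hZ] := ip_antilinear y.
  by rewrite hD hZ (h1 n) // (h2 n) // scaler0 addr0.
Qed.

Lemma word_span_vanishes : exists n, forall x, word_span n x -> x = 0.
Proof.
apply: contrapT => /forallNP hn.
have hex n : exists x, word_span n x /\ x != 0.
  apply: contrapT => /forallNP h; apply: (hn n) => x hx.
  by apply/eqP; apply: contraPT (h x) => nx; apply.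
have [x hx] := choice hex.
have [X hX] : exists X : (\dim {:V}).+1.-tuple V,
    forall i : 'I_(\dim {:V}).+1, X`_i = x i.
  exists [tuple x i | i < (\dim {:V}).+1] => i.
  by rewrite -(tnth_mktuple (fun i : 'I_(\dim {:V}).+1 => x i) i) (tnth_nth 0).
have : free X.
  apply/freeP => k hk i; have [hxi nxi] := hx i.
  have := congr1 (ip (x i)) hk; rewrite ip0.
  rewrite (linear_fun_sum _ _ _ (ip_linear _ : linear (ip (x i) : V -> C^o))).
  rewrite (bigD1 i) //= big1 ?addr0.
    rewrite hX => /eqP; rewrite mulf_eq0 => /orP[/eqP //|].
    by rewrite gt_eqF // hk_ip_pos.
  move=> j nij; rewrite hX; apply/eqP; rewrite mulf_eq0; apply/orP; right.
  have [hxj _] := hx j.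
  case: (ltngtP i j) => [hij|hij|/val_inj hij]; last by rewrite hij eqxx in nij.
    by rewrite hk_ip_herm (word_span_orthogonal hxj hxi hij) rmorph0.
  by rewrite (word_span_orthogonal hxi hxj hij).
rewrite /free size_tuple => /eqP hd.
by have := dimvS (subvf <<X>>%VS); rewrite hd ltnn.
Qed.

(** A nonzero word vector of maximal length.  It is an eigenvector of the K_i; its
    eigenvalues are those of any basis vector occurring in it, whose weight is
    integral, so integrality needs nothing about the root system. *)
Lemma lowest_weight_exists : exists nu (w : V),
  integral_weight nu /\ lowest_weight_vector q nu w.
Proof.
pose P n := `[< forall x, word_span n x -> x = 0 >].
have exP : exists n, P n by have [n hn] := word_span_vanishes; exists n; apply/asboolP.
case: (ex_minnP exP) => -[|n] /asboolP hn hmin.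
  have [nu _ _] := hk_highest V.
  by move: nu; rewrite [tnth _ _]hn ?eqxx //; apply/word_span_vector; constructor.
have [w [hw nw]] : exists w, word_vector n w /\ w != 0.
  apply: contrapT => /forallNP h.
  suff : P n by move/hmin; rewrite ltnn.
  apply/asboolP => x; elim=> [//|y hy|c y z _ -> _ ->]; last by rewrite scaler0 addr0.
  by apply/eqP; apply: contraPT (h y) => ny; apply.
have Fw i : opF V i w = 0 by apply/hn/word_spanF/word_span_vector.
have ew := word_vector_eigen hw.
have [k nk] : exists k, coord (hk_v V) k w != 0.
  apply: contrapT => /forallNP h; move/eqP: nw; apply.
  rewrite (coord_basis (hk_basis V) (memvf w)) big1 // => k _.
  by have /negP := h k; rewrite negbK => /eqP ->; rewrite scale0r.
have [nu inu hnu] := hk_weight k.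
exists nu, w; split=> //; split=> // i.
have [a ha] := ew i; rewrite ha; congr (_ *: _).
have := congr1 (coord (hk_v V) k) ha.
rewrite {1}(coord_basis (hk_basis V) (memvf w)) linear_sum linear_sum.
rewrite (bigD1 k) //= [X in _ + X]big1 ?addr0; last first.
  move=> j njk; have [mu _ hmu] := hk_weight j.
  rewrite -tnth_nth linearZ /= hmu !linearZ /= (tnth_nth 0).
  by rewrite coord_free ?(basis_free (hk_basis V)) // (negPf njk) !mulr0.
rewrite -tnth_nth linearZ /= hnu !linearZ /= (tnth_nth 0).
by rewrite coord_free ?(basis_free (hk_basis V)) // eqxx mulr1 mulrC => /(mulIf nk) ->.
Qed.

Definition riesz (x : V) : pdual V := linfun (ip x : V -> C^o).

Lemma rieszE x y : riesz x y = ip x y.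
Proof. exact: (linfun_linearE (ip_linear x : linear (ip x : V -> C^o))). Qed.

Lemma riesz_basis i : riesz (tnth (hk_v V) i) = tnth (hk_f V) i.
Proof.
apply/lfunP => y; rewrite rieszE tnth_mktuple.
rewrite lfunE /= {1}(coord_basis (hk_basis V) (memvf y)).
rewrite (linear_fun_sum _ _ _ (ip_linear _ : linear (ip _ : V -> C^o))) (bigD1 i) //= big1 ?addr0.
  by rewrite -tnth_nth hk_orthonormal eqxx; apply: mulr1.
move=> j nji; rewrite -tnth_nth hk_orthonormal eq_sym (negPf nji).
exact: mulr0.
Qed.

Lemma riesz_twist : twist (riesz : V -> pdual V).
Proof.
have trE (X : 'End(V)) (h : pdual V) y : transpose X h y = h (X y).
  rewrite /transpose linfun_linearE ?comp_lfunE // => c x z.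
  by apply/lfunP => v; rewrite !(comp_lfunE, add_lfunE, scale_lfunE).
split.
- split=> [x y|c x]; apply/lfunP => z; rewrite ?(add_lfunE, scale_lfunE) !rieszE.
    exact: (ip_antilinear z).1.
  exact: (ip_antilinear z).2.
- by move=> i x; apply/lfunP => z; rewrite /= trE !rieszE hk_ipK.
- move=> i x; apply/lfunP => z; rewrite /= trE !rieszE.
  by rewrite -{1}(KK'E hVr i z) -hk_ipK (KK'E hVr).
- move=> i x; apply/lfunP => z; rewrite /= scale_lfunE trE !rieszE hk_ipE.
  rewrite opp_lfunE comp_lfunE (KFE hVr) -scaleNr ipZ.
  rewrite -[RHS]/(_ * (_ * _)) mulrA mulrNN (qpowKV hq); symmetry; exact: mul1r.
- move=> i x; apply/lfunP => z; rewrite /= scale_lfunE trE !rieszE hk_ipF.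
  have e : opE V i (opK' V i z) = qpow (alpha i, alpha i)f *: opK' V i (opE V i z).
    apply: (can_inj (K'KE hVr i)).
    by rewrite (KEE hVr) (KK'E hVr) linearZ /= (KK'E hVr).
  rewrite opp_lfunE comp_lfunE e -scaleNr ipZ.
  rewrite -[RHS]/(_ * (_ * _)) mulrA mulrNN (qpowVK hq); symmetry; exact: mul1r.
Qed.

Lemma hk_fE i x : tnth (hk_f V) i x = coord (hk_v V) i x.
Proof. by rewrite tnth_mktuple lfunE. Qed.

Lemma dual_expand (h : pdual V) :
  h = \sum_i h (tnth (hk_v V) i) *: tnth (hk_f V) i.
Proof.
apply/lfunP => x; rewrite sum_lfunE {1}(coord_basis (hk_basis V) (memvf x)).
rewrite linear_sum; apply: eq_bigr => i _.
by rewrite linearZ /= -tnth_nth scale_lfunE hk_fE; apply: mulrC.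
Qed.

Lemma dual_basis : basis_of fullv (hk_f V).
Proof.
rewrite basisEdim; apply/andP; split.
  apply/subvP => h _; rewrite (dual_expand h); apply: memv_suml => i _.
  by apply/memvZ/memv_span/mem_tnth.
have free_f : free (hk_f V).
  apply/freeP => k hk i.
  have ek j : (k j *: (hk_f V)`_j : pdual V) (tnth (hk_v V) i) = k j * (i == j)%:R.
    rewrite scale_lfunE -tnth_nth hk_fE (tnth_nth 0).
    by rewrite coord_free ?(basis_free (hk_basis V)).
  have := congr1 (fun h : pdual V => h (tnth (hk_v V) i)) hk.
  rewrite zero_lfunE sum_lfunE (eq_bigr _ (fun j _ => ek j)) (bigD1 i) //= eqxx mulr1.
  rewrite big1 ?addr0 // => j nji.
  by rewrite eq_sym (negPf nji) mulr0.
by rewrite -(eqP free_f) dimvS // subvf.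
Qed.

Lemma riesz_bij : exists J', cancel riesz J' /\ cancel J' riesz.
Proof.
have rA := twist_antilinear riesz_twist.
exists (fun h : pdual V => \sum_i (h (tnth (hk_v V) i))^* *: tnth (hk_v V) i); split=> x.
  rewrite [in RHS](coord_basis (hk_basis V) (memvf x)); apply: eq_bigr => i _.
  by rewrite rieszE -hk_ip_herm -rieszE riesz_basis hk_fE -tnth_nth.
rewrite (antilinear_sum _ _ _ rA) [in RHS](dual_expand x); apply: eq_bigr => i _.
by rewrite conjCK riesz_basis.
Qed.
End Fundamental.

(** * Conjugation of the braiding coefficients *)

Section Components.
Variable R : realType.
Local Notation C := R[i].

Lemma components_comp (U W X Y X' Y' : vectType C) a b c d c' d'
   (bU : a.-tuple U) (bW : b.-tuple W) (bX : c.-tuple X) (bY : d.-tuple Y)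
   (bX' : c'.-tuple X') (bY' : d'.-tuple Y')
   (S : 'Hom(tens X Y, tens X' Y')) (T : 'Hom(tens U W, tens X Y)) k l i j :
  basis_of fullv bX -> basis_of fullv bY ->
  components bU bW bX' bY' (S \o T)%VF k l i j
  = \sum_m \sum_n components bX bY bX' bY' S k l m n * components bU bW bX bY T m n i j.
Proof.
move=> hX hY; rewrite /components comp_lfunE.
rewrite {1}(tcoord_expand (T _) hX hY) !linear_sum; apply: eq_bigr => m _.
rewrite !linear_sum; apply: eq_bigr => n _.
by rewrite linearZ linearZ /=; apply: mulrC.
Qed.

Lemma components_id (U W : vectType C) a b (bU : a.-tuple U) (bW : b.-tuple W) k l i j :
  basis_of fullv bU -> basis_of fullv bW ->
  components bU bW bU bW \1%VF k l i j = (i == k)%:R * (j == l)%:R.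
Proof.
move=> hU hW; rewrite /components id_lfunE tcoord_pure !(tnth_nth 0).
by rewrite !coord_free ?(basis_free hU) ?(basis_free hW).
Qed.

Section TSum.
Variables (g : simpleLie R) (t : cartanData g) (q : R) (s : 'I_(rank t)).
Variable V : fundModule q s.
Local Notation N := (hk_n V).+1.
Implicit Types T : 'I_N -> 'I_N -> 'I_N -> 'I_N -> C.

Lemma eq_tsum (M : lmodType C) T (X Y : 'I_N -> 'I_N -> M) i j :
  (forall k l, X k l = Y k l) -> tsum T X i j = tsum T Y i j.
Proof. by move=> e; apply: eq_bigr => k _; apply: eq_bigr => l _; rewrite e. Qed.

Lemma linear_tsum (M M' : lmodType C) (f : {linear M -> M'}) T X i j :
  f (tsum T X i j) = tsum T (fun k l => f (X k l)) i j.
Proof.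
rewrite /tsum linear_sum; apply: eq_bigr => k _; rewrite linear_sum.
by apply: eq_bigr => l _; rewrite linearZ.
Qed.

Lemma scale_tsum (M : lmodType C) c T (X : 'I_N -> 'I_N -> M) i j :
  tsum T (fun k l => c *: X k l) i j = c *: tsum T X i j.
Proof. exact/esym/(linear_tsum ( *:%R c : {linear M -> M})). Qed.

Lemma tsumE (M : lmodType C) T (X : 'I_N -> 'I_N -> M) i j :
  tsum T X i j = \sum_k \sum_l T i j k l *: X k l.
Proof. by []. Qed.

Lemma tsum_scalel (M : lmodType C) c T (X : 'I_N -> 'I_N -> M) i j :
  tsum (fun i j k l => c * T i j k l) X i j = c *: tsum T X i j.
Proof.
rewrite /tsum scaler_sumr; apply: eq_bigr => k _; rewrite scaler_sumr.
by apply: eq_bigr => l _; rewrite scalerA.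
Qed.

(** Antilinear antimultiplicative maps exchange the two factors, hence the
    exchange of the indices in each pair. *)
Lemma antilinear_tsum (M M' : lmodType C) (f : M -> M') T T' X i j : antilinear f ->
  (forall i j k l, (T i j k l)^* = T' j i l k) ->
  f (tsum T X i j) = tsum T' (fun l k => f (X k l)) j i.
Proof.
move=> hf hT; rewrite /tsum [RHS]exchange_big.
rewrite (big_morph f hf.1 (antilinear0 hf)); apply: eq_bigr => k _.
by rewrite (antilinear_sum _ _ _ hf); apply: eq_bigr => l _; rewrite hT.
Qed.

Lemma tsum_comp (M : lmodType C) (U W X Y X' Y' : vectType C)
   (bU : N.-tuple U) (bW : N.-tuple W) (bX : N.-tuple X) (bY : N.-tuple Y)
   (bX' : N.-tuple X') (bY' : N.-tuple Y')
   (S : 'Hom(tens X Y, tens X' Y')) (T : 'Hom(tens U W, tens X Y))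
   (Z : 'I_N -> 'I_N -> M) k l :
  basis_of fullv bX -> basis_of fullv bY ->
  tsum (components bU bW bX' bY' (S \o T)%VF) Z k l
  = tsum (components bX bY bX' bY' S) (tsum (components bU bW bX bY T) Z) k l.
Proof.
move=> hX hY; rewrite /tsum.
under eq_bigr => i _ do under eq_bigr => j _ do
  (rewrite (@components_comp _ _ _ _ _ _ _ _ _ _ _ _
     bU bW bX bY bX' bY' S T k l i j hX hY) scaler_suml;
   under eq_bigr => m _ do rewrite scaler_suml).
under [RHS]eq_bigr => m _ do under eq_bigr => n _ do
  (rewrite scaler_sumr; under eq_bigr => i _ do rewrite scaler_sumr).
rewrite pair_bigA /= [RHS]pair_bigA /=.
under eq_bigr => p _ do rewrite pair_bigA /=.
under [RHS]eq_bigr => p _ do rewrite pair_bigA /=.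
rewrite exchange_big /=; apply: eq_bigr => p _; apply: eq_bigr => p' _.
by rewrite scalerA.
Qed.

Lemma tsum_id (M : lmodType C) (U W : vectType C) (bU : N.-tuple U) (bW : N.-tuple W)
   (Z : 'I_N -> 'I_N -> M) k l : basis_of fullv bU -> basis_of fullv bW ->
  tsum (components bU bW bU bW \1%VF) Z k l = Z k l.
Proof.
move=> hU hW; rewrite /tsum (bigD1 k) //= [X in _ + X]big1 ?addr0; last first.
  move=> i /negPf ik; rewrite big1 // => j _.
  by rewrite components_id // ik mul0r scale0r.
rewrite (bigD1 l) //= [X in _ + X]big1 ?addr0; last first.
  by move=> j /negPf jl; rewrite components_id // jl mulr0 scale0r.
by rewrite components_id // !eqxx mulr1 scale1r.
Qed.
End TSum.

Section Braiding.
Variables (g : simpleLie R) (t : cartanData g) (q : R) (s : 'I_(rank t)).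
Hypothesis hq : 0 < q < 1.
Variable br : forall M N : preModule t, 'Hom(ptens M N, ptens N M).
Hypothesis hbr : is_braiding q br.
Variable V : fundModule q s.
Local Notation N := (hk_n V).+1.
Local Notation dV := (pdual V).
Local Notation v := (hk_v V).
Local Notation f := (hk_f V).
Let bv : basis_of fullv v := hk_basis V.
Let bf : basis_of fullv f := dual_basis V.

Lemma dual_simple : simple_module q dV.
Proof.
have [J' [JK J'K]] := riesz_bij hq V.
exact: (twist_simple hq JK J'K (riesz_twist hq V)) (hk_simple V).
Qed.

Lemma omega_integral : integral_weight (omega s).
Proof.
exists (fun i => (i == s)%:Z); rewrite (bigD1 s) //= eqxx big1 ?addr0 //.
by move=> i /negPf ->.
Qed.

Lemma braiding_VV_flip (x : ptens V V) :
  flip (@riesz _ _ _ _ _ V) (@riesz _ _ _ _ _ V) (br V V x)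
  = br dV dV (flip (@riesz _ _ _ _ _ V) (@riesz _ _ _ _ _ V) x).
Proof.
have [J' [JK J'K]] := riesz_bij hq V.
have hV := hk_simple V; have [[hVr _] _ _] := hV.
have hJ := riesz_twist hq V; have hu := hk_highest V.
have [nu [w [inu hw]]] := lowest_weight_exists V.
apply: (braiding_flip hq hbr hV hV dual_simple dual_simple hJ hJ
  omega_integral inu hu hw).
  exact: (twist_highest hq JK J'K hJ).
exact: (twist_lowest hq JK J'K hJ).
Qed.

Lemma braiding_VD_flip J' (x : ptens V dV) :
  cancel (@riesz _ _ _ _ _ V) J' -> cancel J' (@riesz _ _ _ _ _ V) ->
  flip J' (@riesz _ _ _ _ _ V) (br V dV x)
  = br V dV (flip (@riesz _ _ _ _ _ V) J' x).
Proof.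
move=> JK J'K.
have hV := hk_simple V; have [[hVr _] _ _] := hV.
have hJ := riesz_twist hq V; have hu := hk_highest V.
have hJ' := twist_inv hq JK J'K hJ.
have lw := twist_highest hq JK J'K hJ hVr hu.
have hdr : Uq_relations q dV by have [[]] := dual_simple.
apply: (braiding_flip hq hbr hV dual_simple dual_simple hV hJ hJ'
  omega_integral (integral_weightN omega_integral) hu lw lw).
exact: (twist_lowest hq J'K JK hJ' hdr lw).
Qed.

Lemma br_invK (A B : preModule t) : Uq_module q A -> Uq_module q B ->
  cancel (br A B) (br A B)^-1%VF /\ cancel (br A B)^-1%VF (br A B).
Proof.
move=> hA hB; have [h hK Kh] := br_bij hbr hA hB; split.
  by apply/lker0_lfunK/lker0P/(can_inj hK).
move=> x; apply: limg_lfunVK; rewrite -(Kh x); exact: memv_img (memvf _).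
Qed.

Let UV : Uq_module q V. Proof. by case: (hk_simple V). Qed.
Let UD : Uq_module q dV. Proof. by case: dual_simple. Qed.

Lemma riesz_antilinear : antilinear (@riesz _ _ _ _ _ V).
Proof. exact: twist_antilinear (riesz_twist hq V). Qed.
Let ra := riesz_antilinear.

Lemma RVV_conj k l i j : (RVV br (V:=V) k l i j)^* = RDD br (V:=V) l k j i :> C.
Proof.
apply: (components_flip ra ra ra ra) => //; try exact: riesz_basis.
exact: braiding_VV_flip.
Qed.

Lemma RVV'_conj k l i j :
  (components v v v v (br V V)^-1%VF k l i j)^* = RDD' br (V:=V) l k j i :> C.
Proof.
apply: (components_flip ra ra ra ra) => //; try exact: riesz_basis.
have [K1 K2] := br_invK UV UV; have [K3 K4] := br_invK UD UD.
by move=> m; apply: (can_inj K3); rewrite K4 -braiding_VV_flip K2.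
Qed.

Lemma PQV_conj k l i j : (PQV br (V:=V) k l i j)^* = PQD br (V:=V) l k j i :> C.
Proof.
apply: (components_flip ra ra ra ra) => //; try exact: riesz_basis.
have [fD fZ] := flip_antilinear (@riesz _ _ _ _ _ V) (@riesz _ _ _ _ _ V).
have fN x : flip (@riesz _ _ _ _ _ V) (@riesz _ _ _ _ _ V) (- x)
  = - flip (@riesz _ _ _ _ _ V) (@riesz _ _ _ _ _ V) x.
  by rewrite -scaleN1r fZ rmorphN1 scaleN1r.
move=> m; rewrite !(comp_lfunE, add_lfunE, opp_lfunE, scale_lfunE, id_lfunE).
rewrite fD fN fZ !braiding_VV_flip fD fZ !braiding_VV_flip qpow_conj.
by rewrite qpow_conj.
Qed.

Lemma RVD_conj k l i j : (RVD br (V:=V) k l i j)^* = RVD br (V:=V) l k j i :> C.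
Proof.
have [J' [JK J'K]] := riesz_bij hq V.
have ra' := twist_antilinear (twist_inv hq JK J'K (riesz_twist hq V)).
have J'f i' : J' (tnth f i') = tnth v i' by rewrite -riesz_basis JK.
apply: (components_flip ra ra' ra' ra) => //; try exact: riesz_basis.
by move=> m; apply: braiding_VD_flip.
Qed.

Lemma RVD'_conj k l i j : (RVD' br (V:=V) k l i j)^* = RVD' br (V:=V) l k j i :> C.
Proof.
have [J' [JK J'K]] := riesz_bij hq V.
have ra' := twist_antilinear (twist_inv hq JK J'K (riesz_twist hq V)).
have J'f i' : J' (tnth f i') = tnth v i' by rewrite -riesz_basis JK.
have [K1 K2] := br_invK UV UD.
apply: (components_flip ra' ra ra ra') => //; try exact: riesz_basis.
by move=> m; apply: (can_inj K1); rewrite K2 -braiding_VD_flip // K2.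
Qed.

Section TSumInverse.
Variables (M : lmodType C) (X : 'I_N -> 'I_N -> M) (i j : 'I_N).

Lemma tsum_RDD'K : tsum (RDD br (V:=V)) (tsum (RDD' br (V:=V)) X) i j = X i j.
Proof.
rewrite -tsum_comp // -[RHS](tsum_id _ _ _ bf bf); congr (tsum (components _ _ _ _ _) _ _ _).
by apply/lfunP => x; rewrite comp_lfunE id_lfunE (br_invK UD UD).2.
Qed.
Lemma tsum_RVVK : tsum (components v v v v (br V V)^-1%VF) (tsum (RVV br (V:=V)) X) i j = X i j.
Proof.
rewrite -tsum_comp // -[RHS](tsum_id _ _ _ bv bv); congr (tsum (components _ _ _ _ _) _ _ _).
by apply/lfunP => x; rewrite comp_lfunE id_lfunE (br_invK UV UV).1.
Qed.
Lemma tsum_RVDK : tsum (RVD' br (V:=V)) (tsum (RVD br (V:=V)) X) i j = X i j.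
Proof.
rewrite -tsum_comp // -[RHS](tsum_id _ _ _ bv bf); congr (tsum (components _ _ _ _ _) _ _ _).
by apply/lfunP => x; rewrite comp_lfunE id_lfunE (br_invK UV UD).1.
Qed.
Lemma tsum_RVD'K : tsum (RVD br (V:=V)) (tsum (RVD' br (V:=V)) X) i j = X i j.
Proof.
rewrite -tsum_comp // -[RHS](tsum_id _ _ _ bf bv); congr (tsum (components _ _ _ _ _) _ _ _).
by apply/lfunP => x; rewrite comp_lfunE id_lfunE (br_invK UV UD).2.
Qed.
Lemma tsum_PQV_comm : tsum (PQV br (V:=V)) (tsum (RVV br (V:=V)) X) i j
  = tsum (RVV br (V:=V)) (tsum (PQV br (V:=V)) X) i j.
Proof.
rewrite -!tsum_comp //; congr (tsum (components _ _ _ _ _) _ _ _).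
apply/lfunP => x; rewrite !(comp_lfunE, add_lfunE, opp_lfunE, scale_lfunE, id_lfunE).
by rewrite !(linearD, linearB, linearN, linearZ).
Qed.
Lemma tsum_PQD_comm : tsum (PQD br (V:=V)) (tsum (RDD' br (V:=V)) X) i j
  = tsum (RDD' br (V:=V)) (tsum (PQD br (V:=V)) X) i j.
Proof.
have [K1 K2] := br_invK UD UD.
rewrite -!tsum_comp //; congr (tsum (components _ _ _ _ _) _ _ _).
apply/lfunP => x; rewrite !(comp_lfunE, add_lfunE, opp_lfunE, scale_lfunE, id_lfunE).
by rewrite !(linearD, linearB, linearN, linearZ) /= !(K1, K2).
Qed.
End TSumInverse.
End Braiding.
End Components.

(** * Antilinear maps between presented calculi *)

Section ConjugateModules.
Variable R : realType.
Local Notation C := R[i].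

Section RestrictLmod.
Variables (A A' : algType C) (phi : {lrmorphism A -> A'}) (M : lmod A').
Definition rest_lact (a : A) (x : M) : M := lact (phi a) x.
Fact rest_linearl c a b x :
  rest_lact (c *: a + b) x = c *: rest_lact a x + rest_lact b x.
Proof. by rewrite /rest_lact linearD linearZ lact_linearl. Qed.
Fact rest_linearr c a x y :
  rest_lact a (c *: x + y) = c *: rest_lact a x + rest_lact a y.
Proof. exact: lact_linearr. Qed.
Fact rest_lact1 x : rest_lact 1 x = x.
Proof. by rewrite /rest_lact rmorph1 lact1. Qed.
Fact rest_lactA a b x : rest_lact (a * b) x = rest_lact a (rest_lact b x).
Proof. by rewrite /rest_lact rmorphM lactA. Qed.
Definition restrict_lmod : lmod A :=
  @LMod R A M rest_lact rest_linearl rest_linearr rest_lact1 rest_lactA.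
End RestrictLmod.

(** Left-linear maps into [conj_lmod] are the antilinear maps theta with
    theta(a x) = theta(x) a^*; they can be built by generators and relations. *)
Section ConjLmod.
Variables (A : algType C) (sA : A -> A) (hs : antimorphism sA) (G : bimod A).
Definition conj_lact (a : A) (x : conj_mod G) : conj_mod G := ract (x : G) (sA a).
Fact conj_lact_linearl c a b x :
  conj_lact (c *: a + b) x = c *: conj_lact a x + conj_lact b x.
Proof.
by case: hs => -[sD sZ] _ _; rewrite /conj_lact sD sZ linearD linearZ.
Qed.
Fact conj_lact_linearr c a x y :
  conj_lact a (c *: x + y) = c *: conj_lact a x + conj_lact a y.
Proof. exact: ract_linearl. Qed.
Fact conj_lact1 x : conj_lact 1 x = x.
Proof. by case: hs => _ s1 _; rewrite /conj_lact s1 ract1. Qed.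
Fact conj_lactA a b x : conj_lact (a * b) x = conj_lact a (conj_lact b x).
Proof. by case: hs => _ _ sM; rewrite /conj_lact sM ractA. Qed.
Definition conj_lmod : lmod A := @LMod R A (conj_mod G) conj_lact
  conj_lact_linearl conj_lact_linearr conj_lact1 conj_lactA.
End ConjLmod.

(** Extending the scalars of a module with generators and relations gives the
    module with the same generators and relations over the larger algebra. *)
Section Extension.
Variables (A0 A : algType C) (phi : {lrmorphism A0 -> A}).
Variables (I : Type) (rel : forall M : lmod A0, (I -> M) -> Prop).
Variables (G0 : lmod A0) (e0 : I -> G0) (G : lmod A) (j : {linear G0 -> G}).
Hypotheses (h0 : presented_lmod rel e0) (hj : scalar_extension phi j).

Lemma extension_exists (M : lmod A) (m : I -> M) :
  rel (M := restrict_lmod phi M) m -> exists f : {linear G -> M},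
    (forall a u, f (lact a u) = lact a (f u)) /\ forall i, f (j (e0 i)) = m i.
Proof.
move=> hm; have [f0 [f0l f0e _]] := h0.2 (restrict_lmod phi M) m hm.
have [f [fl fj _]] := hj.2 M f0 f0l.
by exists f; split=> // i; rewrite fj f0e.
Qed.

Lemma extension_unique (M : lmod A) (f1 f2 : {linear G -> M}) :
  (forall (N : lmod A0) (h : {linear G0 -> N}),
     (forall a u, h (lact a u) = lact a (h u)) -> rel (M := N) (h \o e0)) ->
  (forall a u, f1 (lact a u) = lact a (f1 u)) ->
  (forall a u, f2 (lact a u) = lact a (f2 u)) ->
  (forall i, f1 (j (e0 i)) = f2 (j (e0 i))) -> f1 =1 f2.
Proof.
move=> hrel l1 l2 e.
pose N := restrict_lmod phi M.
pose k1 : {linear G0 -> N} := (f1 \o j : {linear G0 -> M}).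
pose k2 : {linear G0 -> N} := (f2 \o j : {linear G0 -> M}).
have kl1 a u : k1 (lact a u) = lact a (k1 u).
  by rewrite /k1 /= hj.1 l1.
have kl2 a u : k2 (lact a u) = lact a (k2 u).
  by rewrite /k2 /= hj.1 l2.
have [f0 [_ _ f0u]] := h0.2 N (k1 \o e0) (hrel N k1 kl1).
have e1 : k1 =1 f0 by apply: f0u.
have e2 : k2 =1 f0 by apply: f0u => // i; rewrite /k1 /k2 /= e.
have k12 u : f1 (j u) = f2 (j u) by rewrite -[LHS]/(k1 u) -[RHS]/(k2 u) e1 e2.
have [F [_ _ Fu]] := hj.2 M k1 kl1.
have F1 : f1 =1 F by apply: Fu.
have F2 : f2 =1 F by apply: Fu => // u; rewrite -k12.
by move=> u; rewrite F1 F2.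
Qed.
End Extension.
Definition intertwiner (A : algType C) (sA : A -> A) (G G' : bimod A)
    (d : {linear A -> G}) (d' : {linear A -> G'}) (theta : G -> G') : Prop :=
  [/\ antilinear theta,
      forall a u, theta (lact a u) = ract (theta u) (sA a),
      forall a u, theta (ract u a) = lact (sA a) (theta u)
    & forall a, theta (d a) = d' (sA a)].
End ConjugateModules.

(** The x_i and y_i generate A and are exchanged by its star; G is the calculus
    with d x_i free up to the relations PQ and d y_i = 0, and SA, SB give its
    right module structure.  On G' the primed coefficients give the same
    relations read from right to left, with generators e'_i = d' y_i.  The
    section is used with (x, y) = (f, v) and with (x, y) = (v, f). *)
Section Theta.
Variables (R : realType) (g : simpleLie R) (t : cartanData g) (q : R).
Variables (s : 'I_(rank t)) (V : fundModule q s).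
Local Notation C := R[i].
Local Notation N := (hk_n V).+1.
Local Notation tens4 := ('I_N -> 'I_N -> 'I_N -> 'I_N -> C).

Variables (A : algType C) (sA : A -> A) (hs : antimorphism sA).
Variables (x y : 'I_N -> A).
Hypotheses (sx : forall i, sA (x i) = y i) (sy : forall i, sA (y i) = x i).
Hypothesis hind : forall S, subalgebra S -> (forall i, S (x i)) ->
  (forall i, S (y i)) -> forall a, S a.
Variables (A0 : algType C) (phi : {lrmorphism A0 -> A}) (x0 : 'I_N -> A0).
Hypothesis phix : forall i, phi (x0 i) = x i.
Variables (PQ SA SB PQ' SA' SB' : tens4).
Hypotheses (PQc : forall i j k l, (PQ i j k l)^* = PQ' j i l k)
  (SAc : forall i j k l, (SA i j k l)^* = SA' j i l k)
  (SBc : forall i j k l, (SB i j k l)^* = SB' j i l k).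
Variables (G0 : lmod A0) (e0 : 'I_N -> G0).
Hypothesis h0 : presented_lmod (fun (M : lmod A0) (m : 'I_N -> M) =>
  forall k l, tsum PQ (fun i j => lact (x0 i) (m j)) k l = 0) e0.
Variables (G : bimod A) (j : {linear G0 -> G}) (hj : scalar_extension phi j).
Variables (G' : bimod A) (e' : 'I_N -> G').
Hypotheses
  (hA : forall i k, ract (j (e0 i)) (x k)
     = tsum SA (fun a b => lact (x a) (j (e0 b))) i k)
  (hB : forall i k, ract (j (e0 i)) (y k)
     = tsum SB (fun a b => lact (y a) (j (e0 b))) i k)
  (hA' : forall i k, lact (y i) (e' k)
     = tsum SA' (fun a b => ract (e' a) (y b)) i k)
  (hB' : forall i k, lact (x i) (e' k)
     = tsum SB' (fun a b => ract (e' a) (x b)) i k)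
  (hPQ' : forall i k, tsum PQ' (fun a b => ract (e' a) (y b)) i k = 0).
Variables (d : {linear A -> G}) (d' : {linear A -> G'}).
Hypotheses (hd : leibniz d) (hd' : leibniz d').
Hypotheses (dx : forall i, d (x i) = j (e0 i)) (dy : forall i, d (y i) = 0).
Hypotheses (d'y : forall i, d' (y i) = e' i) (d'x : forall i, d' (x i) = 0).

Let M := conj_lmod hs G'.
Let toM_antilinear : antilinear (fun u : conj_mod G' => u : G').
Proof. by []. Qed.

Lemma theta_rel (K : lmod A0) (h : {linear G0 -> K}) :
  (forall a u, h (lact a u) = lact a (h u)) ->
  forall k l, tsum PQ (fun i j => lact (x0 i) ((h \o e0) j)) k l = 0.
Proof.
move=> hl k l; have := congr1 h (h0.1 k l).
rewrite linear_tsum linear0 => <-; apply: eq_tsum => a b.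
by rewrite hl.
Qed.

Lemma leibniz1 (B : algType C) (K : bimod B) (D : {linear B -> K}) :
  leibniz D -> D 1 = 0.
Proof.
move=> hD; have := hD 1 1; rewrite mulr1 ract1 lact1 => e.
by apply: (addrI (D 1)); rewrite -e addr0.
Qed.

(** The generators and relations of G define a left-linear map to the conjugate of
    G'.  For each b, the maps u |-> theta(u b) and u |-> b^* theta(u) are both
    left-linear, so they agree as soon as they agree on the generators, which
    is a relation of G' when b is a generator of A. *)
Theorem theta_exists : exists theta : G -> G', intertwiner sA d d' theta.
Proof.
have [[sD sZ] s1 sM] := hs.
have s0 := antilinear0 (conj sD sZ).
have [f [fl fe]] : exists f : {linear G -> M},
    (forall a u, f (lact a u) = lact a (f u)) /\ forall i, f (j (e0 i)) = e' i.
  apply: (extension_exists h0 hj) => k l.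
  have := hPQ' l k; rewrite -[RHS]/(0 : M) => <-.
  rewrite -(antilinear_tsum _ k l toM_antilinear PQc).
  apply: eq_tsum => a b.
  by rewrite /= /rest_lact /= /conj_lact phix sx.
pose th : G -> G' := f.
have thD u w : th (u + w) = th u + th w by exact: (linearD f).
have thZ c u : th (c *: u) = c^* *: th u by exact: (linearZ_LR f).
have thA : antilinear th by split.
have the i : th (j (e0 i)) = e' i by exact: fe.
have thl a u : th (lact a u) = ract (th u) (sA a) by exact: fl.
have gen b : (forall i, th (ract (j (e0 i)) b) = lact (sA b) (th (j (e0 i)))) ->
    forall u, th (ract u b) = lact (sA b) (th u).
  move=> hb.
  pose f1' (u : G) : M := th (ract u b).
  pose f2' (u : G) : M := lact (sA b) (th u).
  have f1lin : linear f1'.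
    by move=> c u w; rewrite /f1' ractDl ractZl thD thZ.
  have f2lin : linear f2'.
    by move=> c u w; rewrite /f2' thD thZ linearD linearZ.
  pose f1 := HB.pack_for {linear G -> M} f1' (GRing.isLinear.Build C G M *:%R f1' f1lin).
  pose f2 := HB.pack_for {linear G -> M} f2' (GRing.isLinear.Build C G M *:%R f2' f2lin).
  apply: (extension_unique h0 hj (f1 := f1) (f2 := f2)) => //.
  - exact: theta_rel.
  - by move=> a u; rewrite /= /f1' lractA thl.
  - by move=> a u; rewrite /= /f2' thl -lractA.
have thr a u : th (ract u a) = lact (sA a) (th u).
  move: u; apply: (hind (S := fun a => forall u, th (ract u a) = lact (sA a) (th u))).
  - split=> [u|c a1 a2 h1 h2 u|a1 a2 h1 h2 u].
    + by rewrite s1 ract1 lact1.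
    + by rewrite ract_linearr thD thZ h1 h2 sD sZ lact_linearl.
    + by rewrite ractA h2 h1 sM lactA.
  - move=> k; apply: gen => i; rewrite hA (antilinear_tsum _ _ _ thA SAc) the sx hA'.
    by apply: eq_tsum => a' b; rewrite thl the sx.
  - move=> k; apply: gen => i; rewrite hB (antilinear_tsum _ _ _ thA SBc) the sy hB'.
    by apply: eq_tsum => a' b; rewrite thl the sy.
exists th; split=> // a.
apply: (hind (S := fun a => th (d a) = d' (sA a))).
- split=> [|c a1 a2 h1 h2|a1 a2 h1 h2].
  + by rewrite s1 !leibniz1 // (antilinear0 thA).
  + by rewrite linearD linearZ thD thZ h1 h2 sD sZ linearD linearZ.
  + by rewrite hd thD thr thl h1 h2 sM hd' addrC.
- by move=> i; rewrite dx the sx d'y.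
- by move=> i; rewrite dy sy d'x (antilinear0 thA).
Qed.
End Theta.

(** * The degree zero part is generated by the f^i v^j *)

Section NormalForms.
Variables (R : realType) (A : algType R[i]) (I : finType) (z : I + I -> A).
Local Notation C := R[i].
Local Notation f i := (z (inl i)).
Local Notation v i := (z (inr i)).

(** The exchange relations move all v to the right without changing the numbers
    of factors, so every monomial is in some [normal_form a b]. *)
Inductive normal_form : nat -> nat -> A -> Prop :=
| normal_one : normal_form 0 0 1
| normal_f a b x i : normal_form a b x -> normal_form a.+1 b (f i * x)
| normal_v b x i : normal_form 0 b x -> normal_form 0 b.+1 (v i * x)
| normal_0 a b : normal_form a b 0
| normal_lin a b c x y : normal_form a b x -> normal_form a b y ->
    normal_form a b (c *: x + y).

Inductive v_first (a b : nat) : A -> Prop :=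
| v_first_v x i : normal_form a b x -> v_first a b (v i * x)
| v_first_0 : v_first a b 0
| v_first_lin c x y : v_first a b x -> v_first a b y -> v_first a b (c *: x + y).

Lemma linear_pred_sum2 (P : A -> Prop) (c : I -> I -> C) (X : I -> I -> A) :
  linear_pred P -> (forall k l, P (X k l)) ->
  P (\sum_k \sum_l c k l *: X k l).
Proof.
move=> [P0 Plin] hX.
have PD x y : P x -> P y -> P (x + y) by move=> hx hy; rewrite -[x]scale1r; apply: Plin.
apply: (big_ind P) => // k _; apply: (big_ind P) => // l _.
by rewrite -[_ *: _]addr0; apply: Plin.
Qed.

Variables (c c' : I -> I -> I -> I -> C).
Hypothesis exch : forall i j, v i * f j = \sum_k \sum_l c i j k l *: (f k * v l).
Hypothesis exch' : forall i j, f i * v j = \sum_k \sum_l c' i j k l *: (v k * f l).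

Lemma normal_form_linear a b : linear_pred (normal_form a b).
Proof. by split; [exact: normal_0|move=> *; apply: normal_lin]. Qed.
Lemma v_first_linear a b : linear_pred (v_first a b).
Proof. by split; [exact: v_first_0|move=> *; apply: v_first_lin]. Qed.

Lemma sum2_mulr (F : I -> I -> C) (X Y : I -> I -> A) (w : A) :
  (forall k l, X k l * w = Y k l) ->
  (\sum_k \sum_l F k l *: X k l) * w = \sum_k \sum_l F k l *: Y k l.
Proof.
move=> e; rewrite mulr_suml; apply: eq_bigr => k _; rewrite mulr_suml.
by apply: eq_bigr => l _; rewrite -scalerAl e.
Qed.

Lemma normal_form_v a b x i : normal_form a b x -> normal_form a b.+1 (v i * x).
Proof.
move=> h; elim: h i => {a b x} [|a b x j _ IH|b x j hx IH|a b|a b k x y _ IHx _ IHy] i.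
- by apply/normal_v/normal_one.
- rewrite mulrA exch (sum2_mulr _ (Y := fun k l => f k * (v l * x))); last first.
    by move=> k l; rewrite mulrA.
  apply: (linear_pred_sum2 _ (normal_form_linear _ _)) => k l.
  exact/normal_f/IH.
- exact/normal_v/normal_v.
- by rewrite mulr0; apply: normal_0.
- by rewrite mulrDr -scalerAr; apply: normal_lin.
Qed.

Lemma normal_form_word (w : seq (I + I)) : exists a b,
  normal_form a b (\prod_(u <- w) z u) /\
  b%:Z = a%:Z + \sum_(u <- w) (if u is inl _ then -1 else 1).
Proof.
elim: w => [|[i|i] w [a [b [h e]]]].
- by exists 0%N, 0%N; rewrite !big_nil; split=> //; apply: normal_one.
- exists a.+1, b; rewrite !big_cons; split; first exact: normal_f.
  by rewrite e intS addrACA subrr add0r.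
- exists a, b.+1; rewrite !big_cons; split; first exact: normal_form_v.
  by rewrite intS e addrCA.
Qed.

Lemma normal_form_v_first a b x : normal_form a b.+1 x -> v_first a b x.
Proof.
move eb' : b.+1 => b' h; elim: h b eb' => {a b' x}
  [|a b' x i hx IH|b' x i hx _|a b'|a b' k x y _ IHx _ IHy] b eb' //.
- elim: (IH b eb') => [y j hy||k y y' _ hy _ hy'].
  + rewrite mulrA exch' (sum2_mulr _ (Y := fun k l => v k * (f l * y))); last first.
      by move=> k l; rewrite mulrA.
    apply: (linear_pred_sum2 _ (v_first_linear _ _)) => k l.
    exact/v_first_v/normal_f.
  + by rewrite mulr0; apply: v_first_0.
  + by rewrite mulrDr -scalerAr; apply: v_first_lin.
- by case: eb' hx => <-; apply: v_first_v.
- exact: v_first_0.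
- by apply: v_first_lin; [apply: IHx|apply: IHy].
Qed.

Variable S : A -> Prop.
Hypothesis hS : subalgebra S.
Hypothesis Sfv : forall i j, S (f i * v j).

Let Slin : linear_pred S.
Proof.
case: hS => S1 hlin _; split=> //.
by have := hlin (-1) 1 1 S1 S1; rewrite scaleN1r addNr.
Qed.

(** In f (f ... f v ... v) one v can be moved to the front of the bracket, which
    splits off a factor f v. *)
Lemma normal_form_diag n x : normal_form n n x -> S x.
Proof.
have [S1 Sl SM] := hS.
elim: n x => [|n IHn] x.
  move ea : {1}0%N => a; move eb : 0%N => b h.
  elim: h ea eb => {a b x} [|a b x i|b x i|a b|a b k x y _ IHx _ IHy] // ea eb.
    exact: Slin.1.
  by apply: Sl; [apply: IHx|apply: IHy].
move ea : {1}n.+1 => a; move eb : n.+1 => b h.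
elim: h ea eb => {a b x} [|a b x i hx _|b x i|a b|a b k x y _ IHx _ IHy] // ea eb.
- case: ea hx => <-; rewrite -eb => /normal_form_v_first.
  elim=> [y j hy||k y y' _ hy _ hy'].
  + by rewrite mulrA; apply: SM => //; apply: IHn.
  + by rewrite mulr0; apply: Slin.1.
  + by rewrite mulrDr -scalerAr; apply: Sl.
- exact: Slin.1.
- by apply: Sl; [apply: IHx|apply: IHy].
Qed.

Lemma degree0_word (w : seq (I + I)) :
  \sum_(u <- w) (if u is inl _ then -1 else 1) = 0 :> int ->
  S (\prod_(u <- w) z u).
Proof.
have [a [b [h e]]] := normal_form_word w => e0.
move: h; have -> : b = a by move: e; rewrite e0; lia.
exact: normal_form_diag.
Qed.
End NormalForms.

(** * The involution of the Heckenberger-Kolb calculus *)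

Section Descent.
Variable R : realType.
Local Notation C := R[i].
Variables (A Aq B : algType C) (pi : {lrmorphism A -> Aq}) (iota : {lrmorphism B -> Aq}).
Variables (sA : A -> A) (st : B -> B).
Hypothesis lift : forall b, exists a, pi a = iota b /\ pi (sA a) = iota (st b).
Variables (G G' : bimod A) (d : {linear A -> G}) (d' : {linear A -> G'}).
Variables (L : G -> Prop) (L' : G' -> Prop).
Variables (Gq Gq' : fodc Aq) (p : {linear G -> Gq}) (p' : {linear G' -> Gq'}).
Hypotheses (hp : fodc_quotient pi d L p) (hp' : fodc_quotient pi d' L' p').
Variables (GB GB' : fodc B) (j : {linear GB -> Gq}) (j' : {linear GB' -> Gq'}).
Hypotheses (hj : fodc_induced iota j) (hj' : fodc_induced iota j').
Variable theta : G -> G'.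
Hypotheses (hth : intertwiner sA d d' theta)
  (thL : forall u, L u -> L' (theta u)).

(** Choosing the lifts of the coefficients by [lift], a pair in [star_rel] lifts to
    a pair X, theta X; if X lies in the kernel L, then theta X lies in L'. *)
Lemma star_rel_descent (u : GB) (w : GB') : star_rel st u w -> u = 0 -> w = 0.
Proof.
have [thA thl thr thd] := hth.
move=> h; have [X [eX eX']] : exists X, p X = j u /\ p' (theta X) = j' w.
  have [[pl pr pd] _ _] := hp; have [[pl' pr' pd'] _ _] := hp'.
  have [[jl jr jd] _] := hj; have [[jl' jr' jd'] _] := hj'.
  elim: h => [|{}u {}w a b c _ [X [e e']]].
    by exists 0; rewrite (antilinear0 thA) !linear0.
  have [a1 [ea ea']] := lift a; have [b1 [eb eb']] := lift b.
  have [c1 [ec ec']] := lift c.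
  exists (X + ract (lact a1 (d b1)) c1); split.
    by rewrite !linearD e pr pl pd jr jl jd ea eb ec.
  rewrite thA.1 thr thl thd !linearD e' jr' jl' jd'.
  by rewrite -lractA pr' pl' pd' ea' eb' ec'.
move=> u0; have [_ _ pL] := hp; have [_ _ pL'] := hp'; have [_ jinj] := hj'.
apply: jinj; rewrite -eX' linear0; apply/pL'/thL/pL.
by rewrite eX u0 linear0.
Qed.
End Descent.

Section HeckenbergerKolbStar.
Variables (R : realType) (g : simpleLie R) (t : cartanData g).
Variables (s : 'I_(rank t)) (q : R) (hq : 0 < q < 1).
Variable br : forall M N : preModule t, 'Hom(ptens M N, ptens N M).
Hypothesis hbr : is_braiding q br.
Variable V : fundModule q s.
Variable H : hkAlgebras br V.
Local Notation C := R[i].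
Local Notation N := (hk_n V).+1.
Local Notation x i := (AC_z H (inl i)).
Local Notation y i := (AC_z H (inr i)).

Lemma rel_plus_inj (A B : algType C) (h : {lrmorphism A -> B}) (z : 'I_N -> A) :
  injective h -> rel_plus br (h \o z) -> rel_plus br z.
Proof.
move=> hi hz i j; apply: hi; rewrite rmorphM linearZ linear_tsum [LHS]hz.
by congr (_ *: _); apply: eq_tsum => k l; rewrite rmorphM.
Qed.

Lemma rel_minus_inj (A B : algType C) (h : {lrmorphism A -> B}) (z : 'I_N -> A) :
  injective h -> rel_minus br (h \o z) -> rel_minus br z.
Proof.
move=> hi hz i j; apply: hi; rewrite rmorphM linearZ linear_tsum [LHS]hz.
by congr (_ *: _); apply: eq_tsum => k l; rewrite rmorphM.
Qed.

Lemma rel_AC_inj (A B : algType C) (h : {lrmorphism A -> B}) (z : 'I_N + 'I_N -> A) :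
  injective h -> rel_AC br (h \o z) -> rel_AC br z.
Proof.
move=> hi [h1 h2 h3]; split; first exact: (rel_plus_inj hi).
  exact: (rel_minus_inj hi).
move=> i j; apply: hi; rewrite rmorphM linearZ linear_tsum [LHS]h3.
by congr (_ *: _); apply: eq_tsum => k l; rewrite rmorphM.
Qed.

Lemma AC_ind (S : ACx H -> Prop) : subalgebra S ->
  (forall i, S (x i)) -> (forall i, S (y i)) -> forall a, S a.
Proof.
move=> hS hx hy; apply: (presented_alg_ind rel_AC_inj (AC_presented H) hS).
by case.
Qed.

Let id_antilinear (A : algType C) : antilinear (fun u : conj_op A => u : A).
Proof. by []. Qed.

Let RDD_conj i j k l : (RDD br (V:=V) i j k l)^* = RVV br j i l k :> C.
Proof. by rewrite -(RVV_conj hq hbr (V:=V)) conjCK. Qed.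

Lemma rel_AC_conj : rel_AC br (fun u : 'I_N + 'I_N =>
  (match u with inl i => y i | inr i => x i end : conj_op (ACx H))).
Proof.
have [[hp hm he] _] := AC_presented H.
have conjE c T T' (X : 'I_N -> 'I_N -> conj_op (ACx H)) i j :
    (forall i j k l, (T i j k l)^* = T' j i l k) ->
    (qpow q c)^* *: (tsum T X i j : ACx H)
    = qpow q c *: tsum T' (fun l k => X k l : ACx H) j i.
  move=> hT; rewrite qpow_conj; congr (_ *: _).
  exact: (antilinear_tsum _ _ _ (@id_antilinear _) hT).
split=> i j; rewrite conj_opM conj_opZ.
- by rewrite hm (conjE _ _ _ _ _ _ (RVV_conj hq hbr (V:=V))).
- by rewrite hp (conjE _ _ _ _ _ _ RDD_conj).
- by rewrite he (conjE _ _ _ _ _ _ (RVD_conj hq hbr (V:=V))).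
Qed.

Lemma AC_star_exists : exists sA : ACx H -> ACx H,
  [/\ antimorphism sA, forall i, sA (x i) = y i & forall i, sA (y i) = x i].
Proof.
have [_ univ] := AC_presented H.
have [f [fe _]] := univ (conj_op (ACx H) : algType C) _ rel_AC_conj.
exists (f : ACx H -> ACx H); split; first exact: lrmorphism_conj_op.
  by move=> i; apply: (fe (inl i)).
by move=> i; apply: (fe (inr i)).
Qed.

Variables (sA : ACx H -> ACx H) (hs : antimorphism sA).
Hypotheses (sx : forall i, sA (x i) = y i) (sy : forall i, sA (y i) = x i).

Lemma AC_star_c : sA (AC_c H) = AC_c H.
Proof.
have [sl _ sM] := hs.
rewrite /AC_c (big_morph sA sl.1 (antilinear0 sl)); apply: eq_bigr => i _.
by rewrite sM sx sy.
Qed.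

Lemma exchange_inv i j : x i * y j
  = qpow q (- oo s) *: tsum (RVD' br (V:=V)) (fun k l => y k * x l) i j.
Proof.
have [[_ _ he] _] := AC_presented H.
rewrite (eq_tsum _ (Y := fun k l => qpow q (oo s) *:
   tsum (RVD br (V:=V)) (fun a b => x a * y b) k l)); last by move=> k l; apply: he.
by rewrite scale_tsum scalerA (qpowVK hq) scale1r (tsum_RVDK hq hbr).
Qed.

(** The set of b that lift compatibly with the two involutions is a subalgebra, and
    it contains the f^i v^j by the formula for the star of B. *)
Lemma B_lift (st : BB H -> BB H) (hst : hk_star st) b :
  exists a, AA_pi H a = BB_iota H b /\ AA_pi H (sA a) = BB_iota H (st b).
Proof.
pose good (z : AA H) := exists a b, [/\ AA_pi H a = z, BB_iota H b = z
  & AA_pi H (sA a) = BB_iota H (st b)].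
suff : good (BB_iota H b).
  by move=> [a [b' [e1 /(BB_inj (h:=H)) e2 e3]]]; exists a; split=> //; rewrite -e2.
have [hst1 hst2] := hst; have [[sD sZ] s1 sM] := hs.
have hgood : subalgebra good.
  split.
  - by exists 1, 1; split; rewrite ?s1 ?(star1 hst1) !rmorph1.
  - move=> c u w [a [b1 [e1 e2 e3]]] [a' [b1' [e1' e2' e3']]].
    exists (c *: a + a'), (c *: b1 + b1').
    split; rewrite ?sD ?sZ ?(star_add hst1) ?(star_scale hst1) !linearD !linearZ /=.
    - by rewrite e1 e1'.
    - by rewrite e2 e2'.
    - by rewrite e3 e3'.
  - move=> u w [a [b1 [e1 e2 e3]]] [a' [b1' [e1' e2' e3']]].
    exists (a * a'), (b1 * b1').
    split; rewrite ?sM ?(star_mul hst1) !rmorphM /=.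
    - by rewrite e1 e1'.
    - by rewrite e2 e2'.
    - by rewrite e3 e3'.
have gfv i j : exists b, BB_iota H b = AA_z H (inl i) * AA_z H (inr j).
  apply/BB_im; exists 1%N, (fun=> 1), (fun=> [:: inl i; inr j]); split.
    by move=> _; rewrite !big_cons big_nil.
  by rewrite big_ord1 scale1r !big_cons big_nil mulr1.
have good_fv i j : good (AA_z H (inl i) * AA_z H (inr j)).
  have [b1 e1] := gfv i j; have [b2 e2] := gfv j i.
  exists (x i * y j), b1; split=> //; first by rewrite rmorphM.
  by rewrite sM sx sy rmorphM (hst2 i j b1 b2).
have [[_ _ he] _] := AC_presented H.
have exch i j : AA_z H (inr i) * AA_z H (inl j) = \sum_k \sum_l
    (qpow q (oo s) * RVD br (V:=V) i j k l) *: (AA_z H (inl k) * AA_z H (inr l)).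
  rewrite -(tsumE (fun i j k l => qpow q (oo s) * RVD br (V:=V) i j k l)) tsum_scalel.
  rewrite /AA_z -rmorphM /= he linearZ linear_tsum; congr (_ *: _).
  by apply: eq_tsum => k l; rewrite rmorphM.
have exch' i j : AA_z H (inl i) * AA_z H (inr j) = \sum_k \sum_l
    (qpow q (- oo s) * RVD' br (V:=V) i j k l) *: (AA_z H (inr k) * AA_z H (inl l)).
  rewrite -(tsumE (fun i j k l => qpow q (- oo s) * RVD' br (V:=V) i j k l)) tsum_scalel.
  rewrite /AA_z -rmorphM /= exchange_inv linearZ linear_tsum; congr (_ *: _).
  by apply: eq_tsum => k l; rewrite rmorphM.
have [m [c [w [hw ->]]]] : degree_part (AA_z H) 0 (BB_iota H b).
  by apply/BB_im; exists b.
have [g1 glin gM] := hgood.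
have g0 : good 0 by have := glin (-1) 1 1 g1 g1; rewrite scaleN1r addNr.
apply: (big_ind good) => [//|u v hu hv|a _].
  by rewrite -[u]scale1r; apply: glin.
rewrite -[_ *: _]addr0; apply: glin => //.
by apply: (degree0_word exch exch' hgood good_fv); apply: hw.
Qed.

Lemma Lambda_theta (G G' : bimod (ACx H)) (d : {linear ACx H -> G})
    (d' : {linear ACx H -> G'}) (theta : G -> G') :
  intertwiner sA d d' theta -> forall u, hk_Lambda d u -> hk_Lambda d' (theta u).
Proof.
move=> [thA thl thr thd] u hu S hS hgen.
have [S0 SD SM] := hS; have [[sD sZ] s1 _] := hs.
have sc1 : sA (AC_c H - 1) = AC_c H - 1.
  by rewrite sD AC_star_c -scaleN1r sZ s1 rmorphN1 scaleN1r.
apply: (hu (fun u => S (theta u))) => [|z hz].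
  split; first by rewrite (antilinear0 thA).
    by move=> a b ha hb; rewrite thA.1; apply: SD.
  by move=> a z b hz; rewrite thr thl -lractA; apply: SM.
apply: hgen; case: hz => [->|[w ->]|[w ->]].
- by rewrite thd AC_star_c; apply: Or31.
- by rewrite thl sc1; apply: Or33; exists (theta w).
- by rewrite thr sc1; apply: Or32; exists (theta w).
Qed.

Section Theta.
Variables (D : hkDel H) (D' : hkDelbar H).
Local Notation e i := (GpC_j D (Gp_df D i)).
Local Notation e' i := (GmC_j D' (Gm_dv D' i)).

Lemma del_f_right i j : ract (e i) (x j)
  = qpow q (aa s - oo s) *: tsum (RVV br (V:=V)) (fun k l => lact (x k) (e l)) i j.
Proof.
rewrite -ApC_f -GpC_j_ract Gp_ract linearZ linear_tsum; congr (_ *: _).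
by apply: eq_tsum => k l; rewrite (GpC_ext D).1 ApC_f.
Qed.

Lemma delbar_v_right i j : ract (e' i) (y j)
  = qpow q (oo s - aa s) *: tsum (RDD' br (V:=V)) (fun k l => lact (y k) (e' l)) i j.
Proof.
rewrite -AmC_v -GmC_j_ract Gm_ract linearZ linear_tsum; congr (_ *: _).
by apply: eq_tsum => k l; rewrite (GmC_ext D').1 AmC_v.
Qed.

Lemma del_PQ i j : tsum (PQV br (V:=V)) (fun k l => lact (x k) (e l)) i j = 0.
Proof.
have := congr1 (GpC_j D) ((Gp_presented D).1 i j).
rewrite linear0 linear_tsum => <-.
by apply: eq_tsum => k l; rewrite (GpC_ext D).1 ApC_f.
Qed.

Lemma delbar_PQ i j : tsum (PQD br (V:=V)) (fun k l => lact (y k) (e' l)) i j = 0.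
Proof.
have := congr1 (GmC_j D') ((Gm_presented D').1 i j).
rewrite linear0 linear_tsum => <-.
by apply: eq_tsum => k l; rewrite (GmC_ext D').1 AmC_v.
Qed.

Let conj_scale (c : C) (T T' : 'I_N -> 'I_N -> 'I_N -> 'I_N -> C) : c^* = c ->
  (forall i j k l, (T i j k l)^* = T' j i l k) ->
  forall i j k l, (c * T i j k l)^* = c * T' j i l k.
Proof. by move=> hc hT i j k l; rewrite rmorphM /= hc hT. Qed.

Let tsum0 (M : lmodType C) T (X : 'I_N -> 'I_N -> M) i j :
  (forall k l, X k l = 0) -> tsum T X i j = 0.
Proof.
move=> hX; rewrite /tsum big1 // => k _; rewrite big1 // => l _.
by rewrite hX scaler0.
Qed.

Let RDD'_conj i j k l : (RDD' br (V:=V) i j k l)^*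
  = components (hk_v V) (hk_v V) (hk_v V) (hk_v V) (br V V)^-1%VF j i l k :> C.
Proof. by rewrite -(RVV'_conj hq hbr (V:=V)) conjCK. Qed.
Let PQD_conj i j k l : (PQD br (V:=V) i j k l)^* = PQV br j i l k :> C.
Proof. by rewrite -(PQV_conj hq hbr (V:=V)) conjCK. Qed.

Lemma del_to_delbar : exists theta, intertwiner sA (del D) (delbar D') theta.
Proof.
apply: (@theta_exists _ _ _ _ _ V _ sA hs (fun i => x i) (fun i => y i) sx sy AC_ind
  _ (ApC H) (Ap_f H) (ApC_f H)
  (PQV br (V:=V))
  (fun i j k l => qpow q (aa s - oo s) * RVV br (V:=V) i j k l)
  (fun i j k l => qpow q (- oo s) * RVD' br (V:=V) i j k l)
  (PQD br (V:=V))
  (fun i j k l => qpow q (aa s - oo s) * RDD br (V:=V) i j k l)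
  (fun i j k l => qpow q (- oo s) * RVD' br (V:=V) i j k l)
  (PQV_conj hq hbr (V:=V))
  (conj_scale (qpow_conj _ _) (RVV_conj hq hbr (V:=V)))
  (conj_scale (qpow_conj _ _) (RVD'_conj hq hbr (V:=V)))
  _ (Gp_df D) (Gp_presented D) (GpC D) (GpC_j D) (GpC_ext D)
  (GmC D') (fun i => e' i)) => [i j|i j|i j|i j|i j|||i|i|i|i].
- by rewrite tsum_scalel del_f_right.
- by rewrite tsum_scalel GpC_ract.
- rewrite tsum_scalel (eq_tsum _ (Y := fun a b => qpow q (oo s - aa s) *:
    tsum (RDD' br (V:=V)) (fun k l => lact (y k) (e' l)) a b)); last first.
    exact: delbar_v_right.
  by rewrite scale_tsum scalerA -opprB (qpowVK hq) scale1r (tsum_RDD'K hq hbr).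
- rewrite tsum_scalel (eq_tsum _ (Y := fun a b => qpow q (oo s) *:
    tsum (RVD br (V:=V)) (fun k l => lact (x k) (e' l)) a b)); last first.
    exact: GmC_ract.
  by rewrite scale_tsum scalerA (qpowVK hq) scale1r (tsum_RVDK hq hbr).
- rewrite (eq_tsum _ (Y := fun a b => qpow q (oo s - aa s) *:
    tsum (RDD' br (V:=V)) (fun k l => lact (y k) (e' l)) a b)); last first.
    exact: delbar_v_right.
  rewrite scale_tsum (tsum_PQD_comm hq hbr) tsum0 ?scaler0 //.
  exact: delbar_PQ.
- exact: del_leibniz.
- exact: delbar_leibniz.
- exact: del_f.
- exact: del_v.
- exact: delbar_v.
- exact: delbar_f.
Qed.

Lemma delbar_to_del : exists theta, intertwiner sA (delbar D') (del D) theta.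
Proof.
have AC_ind' S : subalgebra S -> (forall i, S (y i)) -> (forall i, S (x i)) ->
    forall a, S a by move=> hS hy hx; apply: AC_ind.
apply: (@theta_exists _ _ _ _ _ V _ sA hs (fun i => y i) (fun i => x i) sy sx AC_ind'
  _ (AmC H) (Am_v H) (AmC_v H)
  (PQD br (V:=V))
  (fun i j k l => qpow q (oo s - aa s) * RDD' br (V:=V) i j k l)
  (fun i j k l => qpow q (oo s) * RVD br (V:=V) i j k l)
  (PQV br (V:=V))
  (fun i j k l => qpow q (oo s - aa s) *
     components (hk_v V) (hk_v V) (hk_v V) (hk_v V) (br V V)^-1%VF i j k l)
  (fun i j k l => qpow q (oo s) * RVD br (V:=V) i j k l)
  PQD_conj
  (conj_scale (qpow_conj _ _) RDD'_conj)
  (conj_scale (qpow_conj _ _) (RVD_conj hq hbr (V:=V)))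
  _ (Gm_dv D') (Gm_presented D') (GmC D') (GmC_j D') (GmC_ext D')
  (GpC D) (fun i => e i)) => [i j|i j|i j|i j|i j|||i|i|i|i].
- by rewrite tsum_scalel delbar_v_right.
- by rewrite tsum_scalel GmC_ract.
- rewrite tsum_scalel (eq_tsum _ (Y := fun a b => qpow q (aa s - oo s) *:
    tsum (RVV br (V:=V)) (fun k l => lact (x k) (e l)) a b)); last first.
    exact: del_f_right.
  by rewrite scale_tsum scalerA -opprB (qpowVK hq) scale1r (tsum_RVVK hbr).
- rewrite tsum_scalel (eq_tsum _ (Y := fun a b => qpow q (- oo s) *:
    tsum (RVD' br (V:=V)) (fun k l => lact (y k) (e l)) a b)); last first.
    exact: GpC_ract.
  by rewrite scale_tsum scalerA (qpowKV hq) scale1r (tsum_RVD'K hq hbr).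
- rewrite (eq_tsum _ (Y := fun a b => qpow q (aa s - oo s) *:
    tsum (RVV br (V:=V)) (fun k l => lact (x k) (e l)) a b)); last first.
    exact: del_f_right.
  rewrite scale_tsum tsum_PQV_comm tsum0 ?scaler0 //.
  exact: del_PQ.
- exact: delbar_leibniz.
- exact: del_leibniz.
- exact: delbar_v.
- exact: delbar_f.
- exact: del_f.
- exact: del_v.
Qed.
End Theta.
End HeckenbergerKolbStar.

Lemma star_rel_map (R : realType) (B : algType R[i]) (st : B -> B)
    (G1 G2 G1' G2' : fodc B) (p1 : {linear G1 -> G1'}) (p2 : {linear G2 -> G2'}) :
  fodc_map idfun (fo_d G1) (fo_d G1') p1 -> fodc_map idfun (fo_d G2) (fo_d G2') p2 ->
  forall u w, star_rel st u w -> star_rel st (p1 u) (p2 w).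
Proof.
move=> [l1 r1 d1] [l2 r2 d2] u w.
elim=> [|{}u {}w a b c _ IH]; first by rewrite !linear0; constructor.
by rewrite !linearD r1 l1 d1 r2 l2 d2; apply: star_relS.
Qed.

Theorem theorem4p2 (R : realType) (g : simpleLie R) (t : cartanData g)
  (s : 'I_(rank t)) (hs : irreducible_flag s)
  (q : R) (hq : 0 < q < 1)
  (br : forall M N : preModule t, 'Hom(ptens M N, ptens N M))
  (hbr : is_braiding q br)
  (V : fundModule q s)
  (H : hkAlgebras br V)
  (st : BB H -> BB H) (hst : hk_star st)
  (D : hkDel H) (D' : hkDelbar H)
  (G : fodc (BB H)) (hG : fodc_direct_sum (Gdel D) (Gdelbar D') G)
  (W : dcalc G) (hW : universal_dcalc W) :
  differential_star_calculus st W.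
Proof.
have [p1 [p2 [pl pr pd pinj]]] := hG.
have [sA [hsA sx sy]] := AC_star_exists hq hbr H.
have lift := B_lift hq hbr hsA sx sy hst.
have m1 : fodc_map idfun (fo_d G) (fo_d (Gdel D)) p1.
  split=> [b u|u b|b]; by [case: (pl b u)|case: (pr u b)|case: (pd b)].
have m2 : fodc_map idfun (fo_d G) (fo_d (Gdelbar D')) p2.
  split=> [b u|u b|b]; by [case: (pl b u)|case: (pr u b)|case: (pd b)].
have [th hth] := del_to_delbar hq hbr hsA sx sy D D'.
have [th' hth'] := delbar_to_del hq hbr hsA sx sy D D'.
have [sg hsg] : exists sg, @fodc_star R (BB H) st G sg.
  apply: (fodc_star_exists hst.1) => w h.
  apply: pinj; rewrite linear0.
    apply: (star_rel_descent lift (GmA_quotient D') (GpA_quotient D)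
      (Gdelbar_induced D') (Gdel_induced D) hth'
      (Lambda_theta hsA sx sy hth') (star_rel_map m2 m1 h)).
    by rewrite linear0.
  apply: (star_rel_descent lift (GpA_quotient D) (GmA_quotient D')
      (Gdel_induced D) (Gdelbar_induced D') hth
      (Lambda_theta hsA sx sy hth) (star_rel_map m1 m2 h)).
  by rewrite linear0.
exact: (@universal_star R (BB H) st hst.1 G W sg hsg hW).
Qed.
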